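(* Let $p$ be a prime and let $G$ be an abelian group of order $4p$. Then $G$ is separable, i.e. every $S$-ring $\mathcal{A}$ over $G$ has the property that every algebraic isomorphism from $\mathcal{A}$ to an $S$-ring over an abelian group is induced by a combinatorial isomorphism.
   Context: Let $G$ be a finite group with identity $e$ and let $\mathbb{Z}G$ be its integral group ring. For $X\subseteq G$ write $\underline{X}=\sum_{x\in X}x\in\mathbb{Z}G$ and $X^{-1}=\{x^{-1}:x\in X\}$. A subring $\mathcal{A}\subseteq\mathbb{Z}G$ is an $S$-ring (Schur ring) over $G$ if there is a partition $\mathcal{S}(\mathcal{A})$ of $G$ (the basic sets) such that $\{e\}\in\mathcal{S}(\mathcal{A})$, $X\in\mathcal{S}(\mathcal{A})$ implies $X^{-1}\in\mathcal{S}(\mathcal{A})$, and $\mathcal{A}$ is the $\mathbb{Z}$-span of $\{\underline{X}:X\in\mathcal{S}(\mathcal{A})\}$. For basic sets $X,Y,Z$ the structure constant $c^Z_{X,Y}$ is the number of pairs $(x,y)\in X\times Y$ with $xy=z$ for a fixed $z\in Z$. For $X\subseteq G$, the Cayley graph $\mathrm{Cay}(G,X)$ has vertex set $G$ and arc set $R(X)=\{(g,xg):g\in G,x\in X\}$. If $\mathcal{A},\mathcal{A}'$ are $S$-rings over $G,G'$, a (combinatorial) isomorphism from $\mathcal{A}$ to $\mathcal{A}'$ is a bijection $f:G\to G'$ such that for every $X\in\mathcal{S}(\mathcal{A})$ the set $X^f$ belongs to $\mathcal{S}(\mathcal{A}')$ and $f$ is a graph isomorphism from $\mathrm{Cay}(G,X)$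 to $\mathrm{Cay}(G',X^f)$. An algebraic isomorphism from $\mathcal{A}$ to $\mathcal{A}'$ is a bijection $\varphi:\mathcal{S}(\mathcal{A})\to\mathcal{S}(\mathcal{A}')$ with $c^Z_{X,Y}=c^{Z^\varphi}_{X^\varphi,Y^\varphi}$ for all basic sets $X,Y,Z$; a combinatorial isomorphism $f$ induces the algebraic isomorphism $X\mapsto X^f$. An $S$-ring is separable if every algebraic isomorphism from it to an $S$-ring over an abelian group is induced by a combinatorial isomorphism; a group is separable if every $S$-ring over it is separable. *)

(* Defs.v *)
From mathcomp Require Import all_boot all_order all_algebra all_fingroup.
Set Implicit Arguments. Unset Strict Implicit. Unset Printing Implicit Defensive.
Import GRing.Theory.
Local Open Scope group_scope.

Section SchurRings.
Variable gT : finGroupType.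

(* Elements of the integral group ring Z[G] are represented as functions
   gT -> int (the coefficient of each group element), supported on G. *)

Definition ind (X : {set gT}) : gT -> int := fun g => Posz ((g \in X) : nat).

Definition gr_mul (G : {set gT}) (f h : gT -> int) : gT -> int :=
  fun z => (\sum_(x in G) f x * h ((x^-1 * z)%g))%R.

Definition in_span (S : {set {set gT}}) (f : gT -> int) : Prop :=
  exists c : {set gT} -> int, forall g, f g = (\sum_(X in S) c X * ind X g)%R.

(* S is the set of basic sets of an S-ring over G:
   a partition of G containing {e}, closed under inversion, whose Z-span is
   a subring of Z[G] (contains 1 = e and closed under multiplication). *)
Definition is_Sring (G : {set gT}) (S : {set {set gT}}) : Prop :=
  [/\ partition S G,
      [set 1] \in S,
      (forall X, X \in S -> X^-1 \in S),
      in_span S (ind [set 1]) &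
      (forall f h, in_span S f -> in_span S h -> in_span S (gr_mul G f h))].

Definition sconst (X Y : {set gT}) (z : gT) : nat :=
  #|[set u in setX X Y | u.1 * u.2 == z]|.

Definition cay_arc (X : {set gT}) (g h : gT) : bool := h * g^-1 \in X.

End SchurRings.

Definition alg_iso (gT gT' : finGroupType)
  (S : {set {set gT}}) (S' : {set {set gT'}}) (phi : {set gT} -> {set gT'}) :=
  [/\ {in S &, injective phi}, phi @: S = S' &
      forall X Y Z, X \in S -> Y \in S -> Z \in S ->
        forall z z', z \in Z -> z' \in phi Z ->
          sconst X Y z = sconst (phi X) (phi Y) z'].

Definition comb_iso (gT gT' : finGroupType)
  (G : {set gT}) (G' : {set gT'})
  (S : {set {set gT}}) (S' : {set {set gT'}}) (f : gT -> gT') :=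
  [/\ {in G &, injective f}, f @: G = G' &
      forall X, X \in S ->
        f @: X \in S' /\
        (forall g h, g \in G -> h \in G ->
           cay_arc X g h = cay_arc (f @: X) (f g) (f h))].

Definition separable_Sring (gT : finGroupType) (G : {group gT})
  (S : {set {set gT}}) : Prop :=
  forall (gT' : finGroupType) (G' : {group gT'}) (S' : {set {set gT'}})
         (phi : {set gT} -> {set gT'}),
    abelian G' -> is_Sring G' S' -> alg_iso S S' phi ->
    exists f : gT -> gT',
      comb_iso G G' S S' f /\ (forall X, X \in S -> phi X = f @: X).

Definition separable_group (gT : finGroupType) (G : {group gT}) : Prop :=
  forall S : {set {set gT}}, is_Sring G S -> separable_Sring G S.

(* Main.v *)
Require Import Defs.
From mathcomp Require Import all_boot all_order all_algebra all_fingroup all_solvable.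
Set Implicit Arguments. Unset Strict Implicit. Unset Printing Implicit Defensive.
Import GRing.Theory.

(* An algebraic isomorphism is encoded by colorings c of G and c' of G' with
   common colors, where [c g = phi X] for g in the basic set X and [c' g' = X']
   for g' in X'; it says that functions agreeing on equally colored elements
   have convolutions that agree.  By Frobenius in characteristic q, so do the
   counts modulo q of the q-th roots of an element inside a color class
   (Schur), whence [c g = c' g'] implies [c (g ^+ m) = c' (g' ^+ m)] for m
   coprime to |G|.

   For p odd write G = K x P with |K| = 4 and |P| = p.  The case q = p shows that
   the k in K whose coset kP is not monochromatic form a union of color classes
   that corresponds to its counterpart in K'.  Counting modulo p and convolving
   then give generators x0 of P and y0 of P' such that the colorings
   k |-> (c k, c (k * x0)) of K and k |-> (c' k, c' (k * y0)) of K' use each color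
   equally often.  In order 4 this and compatibility with inversion suffice for
   a bijection fK : K -> K' preserving the color of quotients, and multiplier
   invariance makes k * x0 ^+ i |-> fK k * y0 ^+ i the required isomorphism.

   For p = 2 all pairs of colorings of the abelian groups of order 8 with equal
   structure constants are enumerated. *)

(** * Colorings of abelian groups of order 4 and 8 *)

(* Colorings of n points up to renaming: the color of a point is the index of the
   first point with the same color. *)
Fixpoint canonical_colorings (n : nat) : seq (seq nat) :=
  if n is n'.+1 then
    flatten [seq [seq rcons t a | a <- rcons (undup t) n'] | t <- canonical_colorings n']
  else [:: [::]].

(** The last point either repeats an earlier color, whose first index is already listed, or receives
    the new index [size s]. *)
Lemma mem_canonical_colorings (T : eqType) (s : seq T) :
  [seq index a s | a <- s] \in canonical_colorings (size s).
Proof.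
elim/last_ind: s => [|s x IHs] //; rewrite size_rcons map_rcons /=.
apply/flatten_mapP; exists [seq index a s | a <- s] => //.
have -> : [seq index a (rcons s x) | a <- s] = [seq index a s | a <- s].
  by apply/eq_in_map => a sa; rewrite -cats1 index_cat sa.
apply: map_f; rewrite mem_rcons inE mem_undup -cats1 index_cat.
have [sx | s'x] := boolP (x \in s); first by apply/orP; right; apply/mapP; exists x.
by rewrite /= eqxx addn0 eqxx.
Qed.

(* (m1, m2, m3) stands for C_m1 x C_m2 x C_m3, whose elements x ^+ a * y ^+ b * z ^+ d
   are indexed by the mixed radix number with digits a, b, d. *)
Definition cyclic_orders := (nat * nat * nat)%type.

Definition undigits (m : cyclic_orders) (a b d : nat) : nat :=
  (d * m.1.2 + b) * m.1.1 + a.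

Definition digit1 (m : cyclic_orders) i := i %% m.1.1.
Definition digit2 (m : cyclic_orders) i := i %/ m.1.1 %% m.1.2.
Definition digit3 (m : cyclic_orders) i := i %/ m.1.1 %/ m.1.2 %% m.2.

Definition quotient_index (m : cyclic_orders) (i j : nat) : nat :=
  undigits m ((digit1 m i + (m.1.1 - digit1 m j)) %% m.1.1)
             ((digit2 m i + (m.1.2 - digit2 m j)) %% m.1.2)
             ((digit3 m i + (m.2 - digit3 m j)) %% m.2).

Definition quotient_table (n : nat) (m : cyclic_orders) : seq (seq nat) :=
  mkseq (fun i => mkseq (quotient_index m i) n) n.

Notation lookup D i j := (nth 0 (nth [::] D i) j).

(** * Exhaustive search for color preserving maps *)

Section Search.
Variables (n : nat) (D D' : seq (seq nat)) (s s' : seq nat).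

Definition cayley_match (F : seq nat) (i j : nat) : bool :=
  eqn (nth 0 s (lookup D i j)) (nth 0 s' (lookup D' (nth 0 F i) (nth 0 F j))).

(** Depth-first search for the images of 0, 1, 2, ..., where [F] lists those chosen so far. A new
    point is compared only with the earlier ones; soundness rests on [cayley_map], which checks the
    result. *)
Fixpoint search_cayley (k : nat) (F : seq nat) : option (seq nat) :=
  if k is k'.+1 then
    foldr (fun j r =>
        let F1 := rcons F j in
        if all (fun l => cayley_match F1 (size F) l && cayley_match F1 l (size F))
             (iota 0 (size F))
        then (if search_cayley k' F1 is Some F2 then Some F2 else r) else r)
      None (iota 0 n)
  else Some F.

(** Injectivity is implicit: in the colorings searched, two points with the same image have a
    quotient of color 0, hence coincide. *)
Definition cayley_map (F : seq nat) : bool :=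
  all (fun i => (nth 0 F i < n) && all (cayley_match F i) (iota 0 n)) (iota 0 n).

End Search.

(* Index 0 is the identity, whose color 0 occurs nowhere else.  The closure
   [test D s] is evaluated once for all s'. *)
Definition always_cayley (n : nat)
    (test : seq (seq nat) -> seq nat -> seq (seq nat) -> seq nat -> bool)
    (types : seq cyclic_orders) : bool :=
  all (fun m => let D := quotient_table n m in
  all (fun t => let s := 0 :: map S t in let test_s := test D s in
    test_s D s ==>
    all (fun m' => let D' := quotient_table n m' in
    all (fun t' => let s' := 0 :: map S t' in
      test_s D' s' ==>
      (if search_cayley n D D' s s' n [::] is Some F then cayley_map n D D' s s' F else false))
    (permutations t)) types)
  (canonical_colorings n.-1)) types.

(** Row 0 of a quotient table lists the inverses. At order 4, compatibility with inversion takes the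
    place of the structure constants. *)
Definition inverse_test (D : seq (seq nat)) (s : seq nat) (D' : seq (seq nat)) (s' : seq nat) :=
  all (fun i => all (fun j =>
    eqn (nth 0 s i) (nth 0 s' j) ==> eqn (nth 0 s (lookup D 0 i)) (nth 0 s' (lookup D' 0 j)))
  (iota 0 4)) (iota 0 4).

(** The entries are the color pairs of the factorizations of element i as k times i / k, so their
    multiplicities are the structure constants at i. *)
Definition color_row (D : seq (seq nat)) (s : seq nat) (i : nat) : nat * seq (nat * nat) :=
  (nth 0 s i, [seq (nth 0 s k, nth 0 s (lookup D i k)) | k <- rev (iota 0 (size s))]).

Definition pair_count (x : nat * nat) : seq (nat * nat) -> nat :=
  count (fun y : nat * nat => eqn x.1 y.1 && eqn x.2 y.2).

(* One row of s for each color suffices, as s is also tested against itself; the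
   last rows and entries come first because they refute most wrong s'. *)
Definition structure_test (D : seq (seq nat)) (s : seq nat) :=
  let R := [seq color_row D s i | i <- rev (iota 0 (size s)) & eqn (find (eqn (nth 0 s i)) s) i] in
  fun (D' : seq (seq nat)) (s' : seq nat) =>
    let R' := [seq color_row D' s' i | i <- rev (iota 0 (size s'))] in
    all (fun r => all (fun r' : nat * seq (nat * nat) => eqn r.1 r'.1 ==>
      all (fun x => eqn (pair_count x r.2) (pair_count x r'.2)) r.2) R') R.

Definition types4 : seq cyclic_orders := [:: (4, 1, 1); (2, 2, 1)].
Definition types8 : seq cyclic_orders := [:: (8, 1, 1); (4, 2, 1); (2, 2, 2)].

Lemma inverse_test_always_cayley : always_cayley 4 inverse_test types4.
(* The search is evaluated once, by the kernel at [Qed]. *)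
Proof. exact_no_check (erefl true). Qed.

(* Only lazy conversion is fast here: under call by value, && and ==> would always
   evaluate both sides. *)
Lemma structure_test_always_cayley : always_cayley 8 structure_test types8.
Proof. exact_no_check (erefl true). Qed.

Local Open Scope group_scope.

(** * Indexing abelian groups of order 4 and 8 *)

Lemma abelian_mulgACA (gT : finGroupType) (G : {group gT}) x y z t :
    abelian G -> x \in G -> y \in G -> z \in G -> t \in G ->
  x * y * (z * t) = x * z * (y * t).
Proof.
by move=> cGG Gx Gy Gz Gt; rewrite -!mulgA; congr (_ * _); rewrite !mulgA (centsP cGG y Gy z Gz).
Qed.

Record presents (n : nat) (m : cyclic_orders) (gT : finGroupType) (G : {set gT})
    (e : nat -> gT) : Prop := Presents {
  presents0 : e 0 = 1;
  presents_mem i : i < n -> e i \in G;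
  presents_ex g : g \in G -> exists2 i, i < n & g = e i;
  presents_inj i j : i < n -> j < n -> e i = e j -> i = j;
  presents_quo i j : i < n -> j < n ->
    quotient_index m i j < n /\ e (quotient_index m i j) = e i * (e j)^-1
}.

Lemma presents_cyclic (m : cyclic_orders) (gT : finGroupType) (G : {group gT}) x y z :
    abelian G -> #|G| = (m.1.1 * m.1.2 * m.2)%N ->
    x \in G -> y \in G -> z \in G -> x ^+ m.1.1 = 1 -> y ^+ m.1.2 = 1 -> z ^+ m.2 = 1 ->
    (forall g, g \in G -> exists i j k, g = x ^+ i * y ^+ j * z ^+ k) ->
  exists e, presents #|G| m G e.
Proof.
case: m => [[m1 m2] m3] /= cGG oG Gx Gy Gz x1 y1 z1 Gxyz.
pose e i := x ^+ digit1 (m1, m2, m3) i * y ^+ digit2 (m1, m2, m3) i * z ^+ digit3 (m1, m2, m3) i.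
have [m1_gt0 m2_gt0 m3_gt0] : [/\ 0 < m1, 0 < m2 & 0 < m3].
  by move: (cardG_gt0 G); rewrite oG !muln_gt0 => /andP[/andP[-> ->] ->].
have undigits_lt a b d : a < m1 -> b < m2 -> d < m3 -> undigits (m1, m2, m3) a b d < #|G|.
  rewrite oG /undigits /= => am bm dm.
  have db : (d * m2 + b < m3 * m2)%N.
    by apply: (@leq_trans (d.+1 * m2)); rewrite ?leq_mul2r ?dm ?orbT // mulSn addnC ltn_add2r.
  apply: (@leq_trans ((d * m2 + b).+1 * m1)); first by rewrite mulSn addnC ltn_add2r.
  by rewrite [leqRHS]mulnC [leqRHS]mulnCA [leqRHS]mulnC leq_mul2r db orbT.
have e_undigits a b d : a < m1 -> b < m2 -> d < m3 ->
    e (undigits (m1, m2, m3) a b d) = x ^+ a * y ^+ b * z ^+ d.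
  move=> am bm dm; rewrite /e /digit1 /digit2 /digit3 /undigits /=.
  rewrite modnMDl divnMDl // (divn_small am) addn0 modnMDl divnMDl // (divn_small bm) addn0.
  by rewrite !modn_small.
have e_ex g : g \in G -> exists2 i, i < #|G| & g = e i.
  move=> /Gxyz[i [j [k ->]]].
  exists (undigits (m1, m2, m3) (i %% m1) (j %% m2) (k %% m3)).
    by rewrite undigits_lt ?ltn_mod.
  by rewrite e_undigits ?ltn_mod // !expg_mod.
(* A list of [#|G|] elements that covers G has no repetition; this gives the injectivity of [e]. *)
have uniq_e : uniq [seq e i | i <- iota 0 #|G|].
  apply/card_uniqP/eqP; rewrite size_map size_iota eqn_leq; apply/andP; split.
    by rewrite (leq_trans (card_size _)) // size_map size_iota.
  apply/subset_leq_card/subsetP=> g /e_ex[i ltiG ->].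
  by apply: map_f; rewrite mem_iota.
exists e; split=> //.
- by rewrite /e /digit1 /digit2 /digit3 !div0n !mod0n !expg0 !mulg1.
- by move=> i _; rewrite !groupM ?groupX.
- move=> i j ltiG ltjG eij; have szG := size_iota 0 #|G|.
  apply/eqP; rewrite -(nth_uniq 1 _ _ uniq_e) ?size_map ?szG //.
  by rewrite !(nth_map 0) ?szG // !nth_iota // !add0n eij.
move=> i j _ _; rewrite /quotient_index /=; split; first by rewrite undigits_lt ?ltn_mod.
rewrite e_undigits ?ltn_mod // !expg_mod //.
have expgBm (w : gT) (k a b : nat) :
    0 < k -> w ^+ k = 1 -> w ^+ (a + (k - b %% k)) = w ^+ a * (w ^+ (b %% k))^-1.
  move=> k_gt0 wk; rewrite expgD; congr (_ * _); apply/eqP.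
  by rewrite -(inj_eq (mulIg (w ^+ (b %% k)))) mulVg -expgD subnK ?wk // ltnW // ltn_mod.
rewrite !expgBm // /e !invMg -/(digit1 _ j) -/(digit2 _ j) -/(digit3 _ j).
rewrite -!/(digit1 _ _) -!/(digit2 _ _) -!/(digit3 _ _).
set a := x ^+ _; set a' := (x ^+ _)^-1; set b := y ^+ _; set b' := (y ^+ _)^-1.
set d := z ^+ _; set d' := (z ^+ _)^-1.
have [Ga Gb Gd] : [/\ a \in G, b \in G & d \in G] by rewrite !groupX.
have [Ga' Gb' Gd'] : [/\ a' \in G, b' \in G & d' \in G] by rewrite !groupV !groupX.
rewrite (centsP cGG b' Gb' a' Ga') (centsP cGG d' Gd' (a' * b')) ?groupM //.
rewrite (abelian_mulgACA cGG (groupM Ga Gb) Gd (groupM Ga' Gb') Gd').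
by rewrite (abelian_mulgACA cGG Ga Gb Ga' Gb').
Qed.

(* The three generators are padded with 1, of order 1, when fewer are needed. *)
Lemma presents_abelian (gT : finGroupType) (G : {group gT}) : abelian G -> #|G| <= 8 ->
  exists m : cyclic_orders, exists2 e, presents #|G| m G e &
    [/\ #|G| = (m.1.1 * m.1.2 * m.2)%N, m.1.2 %| m.1.1, m.2 %| m.1.2 & 0 < m.2].
Proof.
move=> cGG leG8; have [b defG ob] := abelian_structure cGG.
have b_gt1 : all [pred m | 1 < m] [seq #[x] | x <- b] by rewrite ob abelian_type_gt1.
have b_dvd := abelian_type_dvdn_sorted G; rewrite -ob in b_dvd.
have cyc3 x y z : <[x]> \x (<[y]> \x <[z]>) = G -> #[y] %| #[x] -> #[z] %| #[y] ->
    exists m : cyclic_orders, exists2 e, presents #|G| m G e &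
    [/\ #|G| = (m.1.1 * m.1.2 * m.2)%N, m.1.2 %| m.1.1, m.2 %| m.1.2 & 0 < m.2].
  move=> defG3 yx zy.
  have oG : #|G| = (#[x] * #[y] * #[z])%N.
    have [[_ L _ defL] _ _ _] := dprodP defG3; rewrite defL in defG3.
    by rewrite -(dprod_card defG3) -(dprod_card defL) mulnA.
  have Gxyz g : g \in G -> exists i j k, g = x ^+ i * y ^+ j * z ^+ k.
    have [[_ L _ defL] defXL _ _] := dprodP defG3; rewrite -defXL defL.
    have [_ <- _ _] := dprodP defL.
    case/mulsgP=> _ _ /cycleP[i ->] /mulsgP[_ _ /cycleP[j ->] /cycleP[k ->] ->] ->.
    by exists i, j, k; rewrite mulgA.
  have [Gx Gy Gz] : [/\ x \in G, y \in G & z \in G].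
    have [[_ L _ defL] defXL _ _] := dprodP defG3; have [_ defYZ _ _] := dprodP defL.
    have sLG : L \subset G by rewrite -defXL defL mulG_subr.
    have sYL : <[y]> \subset L by rewrite -defYZ mulG_subl.
    have sZL : <[z]> \subset L by rewrite -defYZ mulG_subr.
    split; first by rewrite -cycle_subG -defXL defL mulG_subl.
      by rewrite -cycle_subG (subset_trans sYL).
    by rewrite -cycle_subG (subset_trans sZL).
  have [e Pe] := @presents_cyclic (#[x], #[y], #[z]) _ G x y z cGG oG Gx Gy Gz
    (expg_order x) (expg_order y) (expg_order z) Gxyz.
  by exists (#[x], #[y], #[z]); exists e; rewrite ?order_gt0.
have cardb : (\prod_(x <- b) #[x] = #|G|)%N.
  by rewrite -(bigdprod_card defG).
case: b defG {ob} b_gt1 b_dvd cardb => [|x [|y [|z [|t b]]]] /=.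
- move=> + _ _ _; rewrite big_nil => defG; apply: (cyc3 1 1 1); rewrite ?order1 //.
  by rewrite cycle1 !dprodg1.
- move=> + _ _ _; rewrite big_seq1 => defG; apply: (cyc3 x 1 1); rewrite ?order1 ?dvd1n //.
  by rewrite cycle1 !dprodg1.
- move=> + _ /andP[yx _] _; rewrite big_cons big_seq1 => defG.
  by apply: (cyc3 x y 1); rewrite ?order1 ?dvd1n // cycle1 dprodg1.
- move=> + _ /and3P[yx zy _] _; rewrite !big_cons big_nil dprodg1 => defG.
  exact: (cyc3 x y z).
(* Four nontrivial cyclic factors would already give order at least 16. *)
move=> _ /and5P[x1 y1 z1 t1 b1] _ cardb; have : #|G| < 16 by apply: leq_ltn_trans leG8 _.
suffices : 16 <= #|G| by rewrite leqNgt => /negPf->.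
rewrite -cardb !big_cons -[16]/(2 * (2 * (2 * (2 * 1))))%N.
rewrite !leq_mul // prodn_cond_gt0 // => i _; exact: order_gt0.
Qed.

Lemma dvdn_factors (a b d n : nat) : n = (a * b * d)%N -> 0 < n -> [/\ a <= n, b <= n & d <= n].
Proof.
move=> abd n_gt0; split; apply: dvdn_leq; rewrite // abd.
- by rewrite -mulnA dvdn_mulr.
- by rewrite mulnAC dvdn_mull.
by rewrite dvdn_mull.
Qed.

Lemma presents4 (gT : finGroupType) (G : {group gT}) : abelian G -> #|G| = 4 ->
  exists m e, m \in types4 /\ presents 4 m G e.
Proof.
move=> cGG oG; have [|[[a b] d] [e Pe [+ ba db d_gt0]]] := @presents_abelian _ G cGG.
  by rewrite oG.
rewrite oG /= in Pe ba db d_gt0 * => abd; exists (a, b, d), e; split=> //.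
(* Bounded factors leave finitely many triples, of which the product and the divisibilities keep
   only those in [types4]. *)
have [le_a le_b le_d] := dvdn_factors abd isT.
move: a b d le_a le_b le_d ba db d_gt0 abd {Pe}.
by do 5?[case=> [|]]; do 5?[case=> [|]]; do 5?[case=> [|]].
Qed.

Lemma presents8 (gT : finGroupType) (G : {group gT}) : abelian G -> #|G| = 8 ->
  exists m e, m \in types8 /\ presents 8 m G e.
Proof.
move=> cGG oG; have [|[[a b] d] [e Pe [+ ba db d_gt0]]] := @presents_abelian _ G cGG.
  by rewrite oG.
rewrite oG /= in Pe ba db d_gt0 * => abd; exists (a, b, d), e; split=> //.
have [le_a le_b le_d] := dvdn_factors abd isT.
move: a b d le_a le_b le_d ba db d_gt0 abd {Pe}.
by do 9?[case=> [|]]; do 9?[case=> [|]]; do 9?[case=> [|]].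
Qed.

(** * From searched colorings to colored groups *)

Lemma color_imset_sub (gT gT' : finGroupType) (G : {group gT}) (G' : {group gT'})
    (C : finType) (c : gT -> C) (c' : gT' -> C) :
  (forall a, #|[pred g in G | c g == a]| = #|[pred g in G' | c' g == a]|) ->
  {subset c' @: G' <= c @: G}.
Proof.
move=> cnt _ /imsetP[g Gg ->].
have : 0 < #|[pred x in G | c x == c' g]|.
  by rewrite cnt; apply/card_gt0P; exists g; rewrite !inE Gg eqxx.
by case/card_gt0P=> x; rewrite !inE => /andP[Gx /eqP <-]; apply: imset_f.
Qed.

Section Reflection.
Variables (gT gT' : finGroupType) (G : {group gT}) (G' : {group gT'}).
Variables (C : finType) (c : gT -> C) (c' : gT' -> C).
Variables (n : nat) (m m' : cyclic_orders) (e : nat -> gT) (e' : nat -> gT').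
Hypotheses (eP : presents n m G e) (eP' : presents n m' G' e').

Let code (hT : finGroupType) (h : hT -> C) (u : nat -> hT) (col : C -> nat) :=
  mkseq (fun i => col (h (u i))) n.

Let lookupE i j : i < n -> j < n -> lookup (quotient_table n m) i j = quotient_index m i j.
Proof. by move=> ltin ltjn; rewrite /quotient_table !nth_mkseq. Qed.

Let lookupE' i j : i < n -> j < n -> lookup (quotient_table n m') i j = quotient_index m' i j.
Proof. by move=> ltin ltjn; rewrite /quotient_table !nth_mkseq. Qed.

Let size_code (hT : finGroupType) (h : hT -> C) u col : size (code h u col) = n.
Proof. exact: size_mkseq. Qed.

Let nth_code (hT : finGroupType) (h : hT -> C) u col i :
  i < n -> nth 0 (code h u col) i = col (h (u i)).
Proof. exact: nth_mkseq. Qed.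

Lemma count_presents (hT : finGroupType) (H : {group hT}) k u (Q : pred hT) :
  presents n k H u -> count (fun i => Q (u i)) (iota 0 n) = #|[pred g in H | Q g]|.
Proof.
move=> uP; pose s := [seq u i | i <- iota 0 n].
have uniq_s : uniq s.
  rewrite map_inj_in_uniq ?iota_uniq // => i j; rewrite !mem_iota !add0n => ltin ltjn.
  exact: (presents_inj uP).
have -> : count (fun i => Q (u i)) (iota 0 n) = count Q s by rewrite count_map.
rewrite -size_filter -(card_uniqP (filter_uniq Q uniq_s)).
apply: eq_card => g; rewrite mem_filter !inE andbC; congr (_ && _).
apply/mapP/idP => [[i + ->] | /(presents_ex uP)[i ltin ->]].
  by rewrite mem_iota => ltin; apply: (presents_mem uP).
by exists i; rewrite // mem_iota.
Qed.

(** Number the color of 1 by 0 and any other color by one plus its first index among the nonidentity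
    elements. The code of [c] is then one of the enumerated colorings, and equal color counts make
    the code of [c'] a permutation of it. The test is assumed for every injective numbering because
    this one is chosen inside the proof. *)
Lemma always_cayleyP test types :
    always_cayley n test types -> m \in types -> m' \in types ->
    (forall g, g \in G -> c g = c 1 -> g = 1) ->
    (forall g, g \in G' -> c' g = c' 1 -> g = 1) -> c 1 = c' 1 ->
    (forall a, #|[pred g in G | c g == a]| = #|[pred g in G' | c' g == a]|) ->
    (forall col : C -> nat, {in c @: G &, injective col} ->
       test (quotient_table n m) (code c e col) (quotient_table n m) (code c e col)) ->
    (forall col : C -> nat, {in c @: G &, injective col} ->
       test (quotient_table n m) (code c e col) (quotient_table n m') (code c' e' col)) ->
  exists2 f : gT -> gT', {in G, forall g, f g \in G'} &
    {in G &, forall g h, c (g * h^-1) = c' (f g * (f h)^-1)}.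
Proof.
move=> chk tm tm' c1 c1' cc1 cnt tst tst'.
have n_gt0 : 0 < n by have [i ltin _] := presents_ex eP (group1 G); apply: leq_ltn_trans ltin.
have e0 := presents0 eP; have e0' := presents0 eP'.
pose tail := [seq c (e i) | i <- iota 1 n.-1].
pose tail' := [seq c' (e' i) | i <- iota 1 n.-1].
have iota_n : iota 0 n = 0%N :: iota 1 n.-1 by rewrite -{1}(prednK n_gt0).
have ltn_tail i : i \in iota 1 n.-1 -> (i < n) && (i != 0%N).
  by rewrite mem_iota add1n prednK // -lt0n andbC.
have tail1 i : i \in iota 1 n.-1 -> c (e i) != c 1.
  case/ltn_tail/andP=> ltin; apply: contra => /eqP/(c1 _ (presents_mem eP ltin)) ei.
  by apply/eqP/(presents_inj eP) => //; rewrite ei e0.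
have tail1' i : i \in iota 1 n.-1 -> c' (e' i) != c 1.
  case/ltn_tail/andP=> ltin; apply: contra; rewrite cc1 => /eqP/(c1' _ (presents_mem eP' ltin)) ei.
  by apply/eqP/(presents_inj eP') => //; rewrite ei e0'.
(* With the color of 1 prepended, both lists run over the whole groups, where [cnt] applies. *)
have perm_tail : perm_eq tail tail'.
  rewrite -(perm_cons (c 1)); apply/allP=> a _; apply/eqP.
  change (count_mem a (c 1 :: tail) = count_mem a (c 1 :: tail')).
  have -> : c 1 :: tail = [seq c (e i) | i <- iota 0 n] by rewrite iota_n /= e0.
  have -> : c 1 :: tail' = [seq c' (e' i) | i <- iota 0 n] by rewrite iota_n /= e0' cc1.
  rewrite !count_map.
  by rewrite (count_presents (fun g => c g == a) eP) (count_presents (fun g => c' g == a) eP') cnt.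
pose col a := if a == c 1 then 0%N else (index a tail).+1.
have mem_color a : a \in c @: G -> (a == c 1) || (a \in tail).
  case/imsetP=> g /(presents_ex eP)[i ltin ->] ->.
  have : i \in iota 0 n by rewrite mem_iota.
  rewrite iota_n inE => /orP[/eqP->|ti]; first by rewrite e0 eqxx.
  by rewrite (map_f (fun i => c (e i))) ?orbT.
have col_inj : {in c @: G &, injective col}.
  move=> a b /mem_color Ga /mem_color Gb; rewrite /col.
  move: Ga Gb; case: eqP => [-> | _]; case: eqP => [-> | _] //= ta tb [].
  by move/index_inj; apply.
have codeE : code c e col = 0 :: map S [seq index a tail | a <- tail].
  rewrite /code /mkseq iota_n /= e0 /col eqxx -!map_comp; congr (_ :: _).
  by apply/eq_in_map => i ti /=; rewrite (negPf (tail1 i ti)).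
have codeE' : code c' e' col = 0 :: map S [seq index a tail | a <- tail'].
  rewrite /code /mkseq iota_n /= e0' /col -cc1 eqxx -!map_comp; congr (_ :: _).
  by apply/eq_in_map => i ti /=; rewrite (negPf (tail1' i ti)).
have /allP/(_ _ tm)/allP chk1 := chk.
have /chk1 : [seq index a tail | a <- tail] \in canonical_colorings n.-1.
  by have := mem_canonical_colorings tail; rewrite size_map size_iota.
rewrite /= -codeE tst //= => /allP/(_ _ tm')/allP chk2.
have /chk2 : [seq index a tail | a <- tail'] \in permutations [seq index a tail | a <- tail].
  by rewrite mem_permutations perm_map // perm_sym.
rewrite /= -codeE' tst' //=; case: search_cayley => // F /allP FP.
have F_lt i : i < n -> nth 0 F i < n.
  by move=> ltin; have /FP/andP[] : i \in iota 0 n by rewrite mem_iota.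
have F_match i j : i < n -> j < n ->
    c (e i * (e j)^-1) = c' (e' (nth 0 F i) * (e' (nth 0 F j))^-1).
  move=> ltin ltjn; have /FP/andP[_ /allP Fi] : i \in iota 0 n by rewrite mem_iota.
  have /Fi : j \in iota 0 n by rewrite mem_iota.
  have [q_lt <-] := presents_quo eP ltin ltjn.
  have [q_lt' <-] := presents_quo eP' (F_lt i ltin) (F_lt j ltjn).
  rewrite /cayley_match lookupE // lookupE' ?F_lt // !nth_mkseq // => /eqnP/col_inj; apply.
    by apply: imset_f; apply: (presents_mem eP).
  by apply: (color_imset_sub cnt); apply: imset_f; apply: (presents_mem eP').
pose pos g := index g [seq e i | i <- iota 0 n].
have posP g : g \in G -> pos g < n /\ e (pos g) = g.
  move=> /(presents_ex eP)[i ltin ->].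
  have si : e i \in [seq e i | i <- iota 0 n] by rewrite map_f // mem_iota.
  have lt_pos : pos (e i) < n by rewrite -[X in _ < X](size_iota 0) -(size_map e) index_mem.
  split=> //; rewrite -[RHS](nth_index 1 si) (nth_map 0) ?size_iota //.
  by rewrite nth_iota.
exists (fun g => e' (nth 0 F (pos g))) => [g Gg | g h Gg Gh].
  by have [lt_g _] := posP g Gg; apply: (presents_mem eP'); apply: F_lt.
have [lt_g eg] := posP g Gg; have [lt_h eh] := posP h Gh.
by rewrite -{1}eg -{1}eh F_match.
Qed.

Lemma inverse_testP (col : C -> nat) : n = 4 ->
    (forall g g', g \in G -> g' \in G' -> c g = c' g' -> c g^-1 = c' g'^-1) ->
    {in c @: G &, injective col} -> {subset c' @: G' <= c @: G} ->
  inverse_test (quotient_table n m) (code c e col) (quotient_table n m') (code c' e' col).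
Proof.
move=> n4 cV col_inj sc'c.
rewrite /inverse_test -n4; apply/allP=> i; rewrite mem_iota leq0n add0n => ltin.
apply/allP=> j; rewrite mem_iota leq0n add0n => ltjn.
have n_gt0 : 0 < n by rewrite n4.
rewrite !lookupE ?lookupE' //.
have [q_lt eq] := presents_quo eP n_gt0 ltin.
have [q_lt' eq'] := presents_quo eP' n_gt0 ltjn.
have Gi := presents_mem eP ltin; have Gj := presents_mem eP' ltjn.
rewrite !nth_mkseq // eq eq' (presents0 eP) (presents0 eP') !mul1g.
apply/implyP=> /eqnP/col_inj cij; rewrite (cV _ _ Gi Gj) //; first by case: eqnP.
by apply: cij; [apply: imset_f | apply/sc'c/imset_f].
Qed.

Lemma structure_testP (col : C -> nat) : n = 8 -> abelian G -> abelian G' ->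
    (forall a b g g', g \in G -> g' \in G' -> c g = c' g' ->
       #|[pred x in G | (c x == a) && (c (x^-1 * g) == b)]|
         = #|[pred x in G' | (c' x == a) && (c' (x^-1 * g') == b)]|) ->
    {in c @: G &, injective col} -> {subset c' @: G' <= c @: G} ->
  structure_test (quotient_table n m) (code c e col) (quotient_table n m') (code c' e' col).
Proof.
move=> n8 cGG cGG' cM col_inj sc'c; rewrite /structure_test !size_code.
apply/allP=> r /mapP[i]; rewrite mem_filter mem_rev mem_iota leq0n add0n => /andP[_ ltin] ->.
apply/allP=> r' /mapP[j]; rewrite mem_rev mem_iota leq0n add0n => ltjn ->.
rewrite /color_row !size_code !nth_code //; apply/implyP=> /eqnP cij.
have Gi := presents_mem eP ltin; have Gj := presents_mem eP' ltjn.
have {}cij : c (e i) = c' (e' j) by apply: col_inj cij; [apply: imset_f | apply/sc'c/imset_f].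
apply/allP=> x /mapP[k]; rewrite mem_rev mem_iota leq0n add0n => ltkn ->.
have [q_lt eq] := presents_quo eP ltin ltkn.
rewrite lookupE // !nth_code // eq.
set a := c (e k); set b := c (e i * _).
have Ga : a \in c @: G by apply: imset_f; apply: (presents_mem eP).
have Gb : b \in c @: G by rewrite imset_f // groupM ?groupV ?(presents_mem eP).
rewrite /pair_count !count_map !count_rev.
(* Table entries are quotients z * y^-1 while structure constants involve y^-1 * z; these agree as H
   is abelian. *)
have countE (hT : finGroupType) (H : {group hT}) (h : hT -> C) k' u z :
    abelian H -> presents n k' H u -> {subset h @: H <= c @: G} -> z < n ->
  count (fun l => eqn (col a) (nth 0 (code h u col) l)
              && eqn (col b) (nth 0 (code h u col) (lookup (quotient_table n k') z l))) (iota 0 n)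
    = #|[pred y in H | (h y == a) && (h (y^-1 * u z) == b)]|.
  move=> cHH uP shc ltzn.
  rewrite -(count_presents (fun y => (h y == a) && (h (y^-1 * u z) == b)) uP).
  apply: eq_in_count => l; rewrite mem_iota leq0n add0n => ltln.
  have [ql_lt ql] := presents_quo uP ltzn ltln.
  have [Hl Hz] : u l \in H /\ u z \in H by rewrite !(presents_mem uP).
  have Hlz : (u l)^-1 * u z \in H by rewrite groupM ?groupV.
  have lookupz : lookup (quotient_table n k') z l = quotient_index k' z l.
    by rewrite /quotient_table !nth_mkseq.
  rewrite lookupz !nth_code // ql (centsP cHH (u z) Hz (u l)^-1) ?groupV // !eqnE.
  rewrite (inj_in_eq col_inj Ga (shc _ (imset_f h Hl))).
  rewrite (inj_in_eq col_inj Gb (shc _ (imset_f h Hlz))).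
  by rewrite [a == _]eq_sym [b == _]eq_sym.
apply/eqnP; rewrite (countE _ G c m e) // (countE _ G' c' m' e') //.
exact: cM.
Qed.

End Reflection.

(** Holds by the exhaustive search at order 4. It will be applied to pairs of colors, for which
    counts and inversion are what can be controlled. *)
Lemma order4_cayley (gT gT' : finGroupType) (K : {group gT}) (K' : {group gT'})
    (C : finType) (c : gT -> C) (c' : gT' -> C) :
  #|K| = 4 -> #|K'| = 4 ->
  (forall k, k \in K -> c k = c 1 -> k = 1) ->
  (forall k, k \in K' -> c' k = c' 1 -> k = 1) ->
  c 1 = c' 1 ->
  (forall a, #|[pred k in K | c k == a]| = #|[pred k in K' | c' k == a]|) ->
  (forall k k', k \in K -> k' \in K' -> c k = c' k' -> c k^-1 = c' k'^-1) ->
  exists2 f : gT -> gT', {in K, forall k, f k \in K'} &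
    {in K &, forall k l, c (k * l^-1) = c' (f k * (f l)^-1)}.
Proof.
move=> oK oK' c1 c1' cc1 cnt cV.
have [m [e [tm eP]]] := presents4 (card_p2group_abelian (isT : prime 2) oK) oK.
have [m' [e' [tm' eP']]] := presents4 (card_p2group_abelian (isT : prime 2) oK') oK'.
have sc'c := color_imset_sub cnt.
apply: (always_cayleyP eP eP' inverse_test_always_cayley) => // col col_inj.
  (* Two elements of K with the same color are compared through an element of K' of that color. *)
  apply: (inverse_testP (c := c) (c' := c) eP eP) => // k l Kk Kl ckl.
  have /imsetP[k' Kk' ck'] : c k \in c' @: K'.
    by apply: (color_imset_sub (fun a => esym (cnt a))); apply: imset_f.
  by rewrite (cV k k') // (cV l k') // -ckl.
exact: (inverse_testP (c := c) (c' := c') eP eP').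
Qed.

(** * Matched colorings and the theorems of Schur *)

Lemma eq_sum_const (I J : finType) (V : nmodType) (A : pred I) (B : pred J)
    (h : I -> V) (h' : J -> V) :
  #|A| = #|B| -> (forall i j, A i -> B j -> h i = h' j) ->
  (\sum_(i | A i) h i = \sum_(j | B j) h' j)%R.
Proof.
move=> cAB hE; case: (posnP #|A|) => [A0 | A_gt0].
  rewrite !big_pred0 // => i; first by apply: (card0_eq _ i); rewrite -cAB.
  exact: (card0_eq A0 i).
have /card_gt0P[j0 Bj0] : 0 < #|B| by rewrite -cAB.
have /card_gt0P[i0 Ai0] := A_gt0.
rewrite (eq_bigr (fun=> h' j0)) => [|i Ai]; last exact: hE.
rewrite [RHS](eq_bigr (fun=> h' j0)) => [|j Bj]; last by rewrite -(hE i0) // (hE i0 j0).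
by rewrite !sumr_const cAB.
Qed.

(** Meant for a matrix ring, where the Frobenius map is additive on commuting elements. *)
Lemma Frobenius_sum_comm (R : nzSemiRingType) (q : nat) (I : Type) (r : seq I)
    (P : pred I) (F : I -> R) :
  q \in [pchar R]%R -> {in P &, forall i j, GRing.comm (F i) (F j)} ->
  ((\sum_(i <- r | P i) F i) ^+ q = \sum_(i <- r | P i) F i ^+ q)%R.
Proof.
move=> charq cF; elim: r => [|i r IHr].
  by rewrite !big_nil -(pFrobenius_autE charq) pFrobenius_aut0.
rewrite !big_cons; case: ifP => // Pi.
rewrite -IHr -!(pFrobenius_autE charq) pFrobenius_autD_comm //.
by apply: commr_sum => j Pj; apply: cF.
Qed.

(** * The Frobenius map in the group algebra *)

Section ConvolutionPowers.
Variables (gT : finGroupType) (G : {group gT}) (R : comNzRingType).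

Fixpoint conv_pow (F : gT -> R) (n : nat) (x : gT) : R :=
  if n is n'.+1 then (\sum_(y in G) F y * conv_pow F n' (y^-1 * x)%g)%R
  else ((x == 1%g)%:R)%R.

Let n := #|gT|.-1.
Let cardE : #|gT| = n.+1.
Proof. by rewrite prednK // (cardD1 1). Qed.
Let elt (i : 'I_n.+1) : gT := enum_val (cast_ord (esym cardE) i).
Let idx (x : gT) : 'I_n.+1 := cast_ord cardE (enum_rank x).
Let idxK : cancel idx elt.
Proof. by move=> x; rewrite /elt cast_ordK enum_rankK. Qed.
Let eltK : cancel elt idx.
Proof. by move=> i; rewrite /idx enum_valK cast_ordKV. Qed.

(* The right regular representation: conv_pow F k lists the coefficients of the k-th
   power of an element of the group algebra. *)
Let E (x : gT) : 'M[R]_n.+1 := (\matrix_(i, j) (elt i * x == elt j)%g%:R)%R.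

Let EM x y : (E x * E y)%R = E (x * y).
Proof.
apply/matrixP=> i j; rewrite !mxE (bigD1 (idx (elt i * x))) //= !mxE idxK eqxx mul1r.
rewrite big1 ?addr0 ?mulgA // => k Dk; rewrite !mxE.
by case: eqP => [ei|]; rewrite ?mul0r // ei eltK eqxx in Dk *.
Qed.

Let E1 : E 1 = 1%R.
Proof. by apply/matrixP=> i j; rewrite !mxE mulg1 (can_eq eltK). Qed.

Let EX x k : (E x ^+ k)%R = E (x ^+ k)%g.
Proof. by elim: k => [|k IHk]; rewrite ?expg0 ?E1 // exprS IHk EM expgS. Qed.

Let conv_powE F k :
  ((\sum_(x in G) F x *: E x) ^+ k = \sum_(x in G) conv_pow F k x *: E x)%R.
Proof.
elim: k => [|k IHk].
  rewrite expr0 (bigD1 1) //= eqxx scale1r E1 big1 ?addr0 // => x /andP[_ /negPf->].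
  by rewrite scale0r.
rewrite exprS IHk mulr_suml /=.
under [RHS]eq_bigr do rewrite scaler_suml.
rewrite [RHS]exchange_big /=; apply: eq_bigr => y Gy.
rewrite mulr_sumr [RHS](reindex_inj (mulgI y)) /=.
apply: eq_big => [x|x Gx]; first by rewrite groupMl.
by rewrite mulKg -scalerAl -scalerAr EM scalerA.
Qed.

(** The matrices [E y] with y in G commute, so the q-th power of the sum of the F y *: E y is the
    sum of the F y ^+ q *: E (y ^+ q). The entry in row 1 and column x is the coefficient of x. *)
Lemma conv_pow_Frobenius (F : gT -> R) (q : nat) (x : gT) :
    abelian G -> q \in [pchar R]%R -> x \in G ->
  conv_pow F q x = (\sum_(y in G | (y ^+ q)%g == x) F y ^+ q)%R.
Proof.
move=> cGG charq Gx.
have charM : q \in [pchar 'M[R]_n.+1]%R.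
  by rewrite inE (pcharf_prime charq) -scaler_nat (pcharf0 charq) scale0r eqxx.
have coefE (H : gT -> R) z : z \in G ->
    (\sum_(y in G) H y *: E y)%R (idx 1) (idx z) = H z.
  move=> Gz; rewrite summxE (bigD1 z) //= big1 => [|y /andP[_ /negPf yz]].
    by rewrite !mxE !idxK mul1g eqxx mulr1 addr0.
  by rewrite !mxE !idxK mul1g yz mulr0.
rewrite -(coefE (conv_pow F q)) // -conv_powE.
rewrite Frobenius_sum_comm // => [|y z Gy Gz]; last first.
  by rewrite /GRing.comm -!scalerAl -!scalerAr !EM (centsP cGG _ Gy _ Gz) !scalerA mulrC.
rewrite summxE [RHS]big_mkcondr; apply: eq_bigr => y _ /=.
rewrite exprZn EX !mxE !idxK mul1g.
by case: eqP; rewrite ?mulr1 ?mulr0.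
Qed.

End ConvolutionPowers.

Record matched (gT gT' : finGroupType) (G : {set gT}) (G' : {set gT'})
    (C : finType) (c : gT -> C) (c' : gT' -> C) : Prop := Matched {
  matched1 : c 1 = c' 1;
  matched_inj1 x : x \in G -> c x = c 1 -> x = 1;
  matched_inj1' x' : x' \in G' -> c' x' = c' 1 -> x' = 1;
  matched_ex x : x \in G -> exists2 x', x' \in G' & c x = c' x';
  matched_ex' x' : x' \in G' -> exists2 x, x \in G & c x = c' x';
  matchedV x x' : x \in G -> x' \in G' -> c x = c' x' -> c x^-1 = c' x'^-1;
  matchedM a b x x' : x \in G -> x' \in G' -> c x = c' x' ->
    #|[set y in G | (c y == a) && (c (y^-1 * x) == b)]| =
    #|[set y in G' | (c' y == a) && (c' (y^-1 * x') == b)]|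
}.

Lemma matched_sym (gT gT' : finGroupType) (G : {set gT}) (G' : {set gT'})
    (C : finType) (c : gT -> C) (c' : gT' -> C) :
  matched G G' c c' -> matched G' G c' c.
Proof.
move=> M; split.
- by rewrite (matched1 M).
- exact: matched_inj1' M.
- exact: matched_inj1 M.
- by move=> x' /(matched_ex' M)[x Gx cx]; exists x.
- by move=> x /(matched_ex M)[x' Gx' cx]; exists x'.
- by move=> x' x Gx' Gx cx; rewrite (matchedV M Gx Gx').
- by move=> a b x' x Gx' Gx cx; rewrite (matchedM M a b Gx Gx').
Qed.

(** * Corresponding functions on the two groups *)

Section Agree.
Variables (gT gT' : finGroupType) (G : {group gT}) (G' : {group gT'}).
Variables (C : finType) (c : gT -> C) (c' : gT' -> C).
Hypothesis M : matched G G' c c'.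

(** Forces F and F' to be constant on color classes. With values in a ring, they are elements of the
    two S-rings, with coefficients extended, that the algebraic isomorphism exchanges. *)
Definition agree (T : Type) (F : gT -> T) (F' : gT' -> T) :=
  forall x x', x \in G -> x' \in G' -> c x = c' x' -> F x = F' x'.

Lemma agree_const T (a : T) : agree (fun=> a) (fun=> a). Proof. by []. Qed.

Lemma agree_color_eq a : agree (fun x => c x == a) (fun x => c' x == a).
Proof. by move=> x x' _ _ ->. Qed.

Lemma agree_eq1 : agree (pred1 1) (pred1 1).
Proof.
move=> x x' Gx Gx' cx /=; apply/eqP/eqP=> [x1 | x1].
  by apply: (matched_inj1' M) => //; rewrite -(matched1 M) -cx x1.
by apply: (matched_inj1 M) => //; rewrite (matched1 M) cx x1.
Qed.

Lemma agreeV T (F : gT -> T) F' :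
  agree F F' -> agree (fun x => F x^-1) (fun x => F' x^-1).
Proof. by move=> FF x x' Gx Gx' /(matchedV M Gx Gx'); apply: FF; rewrite groupV. Qed.

(** Group the y by the colors of y and y^-1 * x: corresponding groups have the same size by
    [matchedM] and the same constant summand. A general [op] covers products, conjunctions and, by
    ignoring an argument, plain sums. *)
Lemma agree_conv (V : nmodType) T1 T2 (op : T1 -> T2 -> V) F1 F1' F2 F2' :
    agree F1 F1' -> agree F2 F2' ->
  agree (fun x => \sum_(y in G) op (F1 y) (F2 (y^-1 * x)%g))%R
        (fun x => \sum_(y in G') op (F1' y) (F2' (y^-1 * x)%g))%R.
Proof.
move=> FF1 FF2 x x' Gx Gx' cx.
rewrite (partition_big (fun y => (c y, c (y^-1 * x))) predT) //.
rewrite [RHS](partition_big (fun y => (c' y, c' (y^-1 * x'))) predT) //=.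
apply: eq_bigr => -[a b] _; apply: eq_sum_const.
  have := matchedM M a b Gx Gx' cx; rewrite !cardsE.
  by move=> cE; etransitivity; last etransitivity; [| exact: cE |]; apply: eq_card.
move=> y y' /andP[Gy /eqP[<- <-]] /andP[Gy' /eqP[cy cyx]].
by congr op; [exact: FF1 | apply: FF2; rewrite ?groupM ?groupV].
Qed.

(** Inverting the summation variable turns this correlation into a convolution. *)
Lemma agree_corr (V : nmodType) T1 T2 (op : T1 -> T2 -> V) F1 F1' F2 F2' :
    agree F1 F1' -> agree F2 F2' ->
  agree (fun x => \sum_(y in G) op (F1 y) (F2 (y * x)%g))%R
        (fun x => \sum_(y in G') op (F1' y) (F2' (y * x)%g))%R.
Proof.
move=> /agreeV FF1 FF2 x x' Gx Gx' cx.
have := agree_conv op FF1 FF2 Gx Gx' cx.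
rewrite (reindex_inj invg_inj) [X in _ = X -> _](reindex_inj invg_inj) /=.
under eq_bigl do rewrite groupV; under eq_bigr do rewrite invgK.
under [X in _ = X -> _]eq_bigl do rewrite groupV.
by under [X in _ = X -> _]eq_bigr do rewrite invgK.
Qed.

Lemma agree_sum (V : nmodType) (F : gT -> V) F' :
  agree F F' -> (\sum_(x in G) F x = \sum_(x in G') F' x)%R.
Proof.
move=> FF.
exact: (agree_conv (fun a _ => a) FF (agree_const tt)) (group1 G) (group1 G') (matched1 M).
Qed.

Lemma agree_card (A : pred gT) (A' : pred gT') :
  agree A A' -> #|[pred x in G | A x]| = #|[pred x in G' | A' x]|.
Proof.
move=> AA; have := @agree_sum nat (fun x => A x : nat) (fun x => A' x : nat).
rewrite -!sum1_card !big_mkcondr /= => -> // x x' Gx Gx' cx.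
by rewrite (AA x x').
Qed.

Lemma matched_card : #|G| = #|G'|.
Proof.
have := agree_card (agree_const true : agree predT predT).
by congr (_ = _); apply: eq_card => x; rewrite !inE andbT.
Qed.

(** In characteristic q both sums are q-th convolution powers, which agree by iterating [agree_conv]
    from the indicator of 1. *)
Lemma agree_power_sum (R : comNzRingType) (q : nat) (F : gT -> R) F' :
    abelian G -> abelian G' -> q \in [pchar R]%R -> agree F F' ->
  agree (fun x => \sum_(y in G | (y ^+ q)%g == x) F y ^+ q)%R
        (fun x => \sum_(y in G' | (y ^+ q)%g == x) F' y ^+ q)%R.
Proof.
move=> cGG cGG' charq FF x x' Gx Gx' cx; rewrite -!conv_pow_Frobenius //.
elim: q {charq} x x' Gx Gx' cx => [|q IHq] x x' Gx Gx' cx /=.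
  by have /= -> := agree_eq1 Gx Gx' cx.
exact: (agree_conv (fun a b => a * b)%R FF IHq Gx Gx' cx).
Qed.

(* Schur's theorem on the q-th power of a basic set, read modulo q. *)
Lemma agree_card_power (q : nat) (A : pred gT) (A' : pred gT') x x' :
    abelian G -> abelian G' -> prime q -> agree A A' ->
    x \in G -> x' \in G' -> c x = c' x' ->
  #|[pred y in G | A y && (y ^+ q == x)]|
    = #|[pred y in G' | A' y && (y ^+ q == x')]| %[mod q].
Proof.
move=> cGG cGG' q_pr AA Gx Gx' cx.
have charq : q \in [pchar 'F_q]%R by apply: pchar_Fp.
have FF : agree (fun y => (A y)%:R : 'F_q)%R (fun y => (A' y)%:R : 'F_q)%R.
  by move=> y y' Gy Gy' cy; have /= -> := AA y y' Gy Gy' cy.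
have := agree_power_sum cGG cGG' charq FF Gx Gx' cx.
have cardE (hT : finGroupType) (H : {group hT}) (B : pred hT) z :
    (\sum_(y in H | (y ^+ q)%g == z) (B y)%:R ^+ q
      = #|[pred y in H | B y && (y ^+ q == z)%g]|%:R :> 'F_q)%R.
  rewrite -sum1_card natr_sum [RHS]big_mkcond [LHS]big_mkcond; apply: eq_bigr => y _.
  rewrite !inE; case: (y \in H) => //=; case: (B y) => /=; case: eqP => //= _.
    by rewrite expr1n.
  by rewrite expr0n; case: (q) q_pr.
rewrite !cardE => /(congr1 val) /=; rewrite !val_Fp_nat // Fp_cast //.
Qed.

End Agree.

Lemma order8_cayley (gT gT' : finGroupType) (G : {group gT}) (G' : {group gT'})
    (C : finType) (c : gT -> C) (c' : gT' -> C) :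
  matched G G' c c' -> abelian G -> abelian G' -> #|G| = 8 ->
  exists2 f : gT -> gT', {in G, forall g, f g \in G'} &
    {in G &, forall g h, c (g * h^-1) = c' (f g * (f h)^-1)}.
Proof.
move=> M cGG cGG' oG; have oG' : #|G'| = 8 by rewrite -(matched_card M).
have [m [e [tm eP]]] := presents8 cGG oG.
have [m' [e' [tm' eP']]] := presents8 cGG' oG'.
have cardE (hT : finGroupType) (H : {group hT}) (h : hT -> C) g a b :
  #|[set y in H | (h y == a) && (h (y^-1 * g) == b)]|
    = #|[pred y in H | (h y == a) && (h (y^-1 * g) == b)]|.
  by apply: eq_card => y; rewrite !inE.
have cnt a : #|[pred g in G | c g == a]| = #|[pred g in G' | c' g == a]|.
  exact: (agree_card M (agree_color_eq (G := G) (G' := G') (c := c) (c' := c') a)).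
apply: (always_cayleyP eP eP' structure_test_always_cayley) => // [||| col col_inj | col col_inj].
- exact: matched_inj1 M.
- exact: matched_inj1' M.
- exact: matched1 M.
- apply: (structure_testP (c := c) (c' := c) eP eP) => // a b g h Gg Gh cgh.
  have [x' Gx' cx'] := matched_ex M Gg.
  have := matchedM M a b Gg Gx' cx'; rewrite !cardE => ->.
  by have := matchedM M a b Gh Gx'; rewrite !cardE => -> //; rewrite -cgh.
apply: (structure_testP (c := c) (c' := c') eP eP') => // [a b g g' Gg Gg' cg|].
  by have := matchedM M a b Gg Gg' cg; rewrite !cardE.
exact: color_imset_sub.
Qed.

(** * Multipliers *)

Section Multipliers.
Variables (gT gT' : finGroupType) (G : {group gT}) (G' : {group gT'}).
Variables (C : finType) (c : gT -> C) (c' : gT' -> C).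
Hypotheses (M : matched G G' c c') (cGG : abelian G) (cGG' : abelian G').

(** As x is the only q-th root of x ^+ q, the number of such roots of color c x is 1. Modulo q the
    count for x' ^+ q is the same, hence not zero, and the only root available is x'. *)
Let expg_root_prime q x x' : prime q -> coprime #|G| q -> x \in G -> x' \in G' ->
  c (x ^+ q) = c' (x' ^+ q) -> c x = c' x'.
Proof.
move=> q_pr co_q Gx Gx' cq.
have := agree_card_power M cGG cGG' q_pr (agree_color_eq (c x)) (groupX q Gx) (groupX q Gx') cq.
rewrite (@eq_card1 _ x) => [|y]; last first.
  rewrite !inE; apply/and3P/eqP => [[Gy _ /eqP yq] | ->]; last by rewrite Gx !eqxx.
  by rewrite -(expgK co_q Gy) yq expgK.
case: (posnP #|[pred y in G' | (c' y == c x) && (y ^+ q == x' ^+ q)]|) => [-> | ].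
  by rewrite mod0n modn_small ?prime_gt1.
case/card_gt0P=> y; rewrite !inE => /and3P[Gy /eqP<- /eqP yq] _.
rewrite (matched_card M) in co_q.
by rewrite -[y in LHS](expgK co_q Gy) yq expgK.
Qed.

Let expg_root m x x' : coprime #|G| m -> x \in G -> x' \in G' ->
  c (x ^+ m) = c' (x' ^+ m) -> c x = c' x'.
Proof.
elim/ltn_ind: m x x' => m IHm x x' co_m Gx Gx' cm.
have [m_gt1 | m_le1] := ltnP 1 m.
  have q_pr := pdiv_prime m_gt1; have Dm := divnK (pdiv_dvd m).
  move: co_m cm; rewrite -{1 2 3}Dm coprimeMr !expgM => /andP[co_r co_q] cm.
  apply: (IHm (m %/ pdiv m)) => //.
    by rewrite ltn_Pdiv ?prime_gt1 // ltnW.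
  by apply: (expg_root_prime q_pr); rewrite ?groupX.
(* The exponent 0 is coprime to the order of G only if G is trivial. *)
case: m m_le1 co_m cm {IHm} => [|[|//]] _ co_m; last by rewrite !expg1.
move: co_m; rewrite /coprime gcdn0 => /eqP G1 _.
have x1: x = 1 by apply/set1P; rewrite -[[set 1]](card1_trivg G1).
have x'1: x' = 1.
  by apply/set1P; rewrite -[[set 1]](@card1_trivg _ G') // -(matched_card M).
by rewrite x1 x'1 (matched1 M).
Qed.

(* Schur's theorem on multipliers. *)
Lemma matched_expg m x x' : coprime #|G| m -> x \in G -> x' \in G' ->
  c x = c' x' -> c (x ^+ m) = c' (x' ^+ m).
Proof.
move=> co_m Gx Gx' cx.
(* By Euler's theorem a further power of m undoes [x ^+ m]; [expg_root] for that exponent then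
   applies to x ^+ m and x' ^+ m. *)
have expK (hT : finGroupType) (H : {group hT}) y : #|H| = #|G| -> y \in H ->
    (y ^+ m) ^+ (m ^ (totient #|G|).-1) = y.
  move=> oH Hy; rewrite -expgM -expnS prednK ?totient_gt0 ?cardG_gt0 //.
  rewrite -[RHS]expg1; apply/eqP; rewrite eq_expg_mod_order.
  have oy : #[y] %| #|G| by rewrite -oH order_dvdG.
  rewrite -(modn_dvdm _ oy) Euler_exp_totient 1?coprime_sym //.
  by rewrite modn_dvdm.
have GG' := matched_card M.
apply: (@expg_root (m ^ (totient #|G|).-1)); rewrite ?groupX //.
  by case: _.-1 => [|t]; rewrite ?coprimen1 // coprime_pexpr.
by rewrite (expK _ G) // (expK _ G').
Qed.

End Multipliers.

(** * Groups of order 4p for odd p *)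

(** The layer of k is the coset k * P. *)
Definition layer_count (gT : finGroupType) (P : {set gT}) (C : eqType)
    (c : gT -> C) (k : gT) (a : C) : nat :=
  #|[pred x in P | c (k * x) == a]|.

Definition split_layer (gT : finGroupType) (K P : {set gT}) (C : eqType)
    (c : gT -> C) (k : gT) : bool :=
  (k \in K) && [exists x in P, c (k * x) != c k].

(* For k in a group of order 4 and p odd, this is [k ^+ p]. *)
Definition pm1 (p : nat) (gT : finGroupType) (k : gT) : gT :=
  if p %% 4 == 1%N then k else k^-1.

(** * Layers of the direct product K x P *)

Section Coordinates.
Variables (p : nat) (gT : finGroupType) (G K P : {group gT}).
Hypothesis p_odd : odd p.
Hypotheses (cGG : abelian G) (defG : K \x P = G) (oK : #|K| = 4) (oP : #|P| = p).

Lemma coord_subl : K \subset G. Proof. by case/dprodP: defG => _ <- _ _; apply: mulG_subl. Qed.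
Lemma coord_subr : P \subset G. Proof. by case/dprodP: defG => _ <- _ _; apply: mulG_subr. Qed.

Lemma coordM k x : k \in K -> x \in P -> k * x \in G.
Proof. by move=> Kk Px; rewrite groupM ?(subsetP coord_subl k) ?(subsetP coord_subr x). Qed.

Lemma coordX k x n : k \in K -> x \in P -> (k * x) ^+ n = k ^+ n * x ^+ n.
Proof.
move=> Kk Px; apply: expgMn; apply: (centsP cGG).
  exact: (subsetP coord_subl).
exact: (subsetP coord_subr).
Qed.

Lemma coordP g : g \in G -> exists2 k, k \in K & exists2 x, x \in P & g = k * x.
Proof. by case/dprodP: defG => _ <- _ _ /mulsgP[k x Kk Px ->]; exists k => //; exists x. Qed.

Lemma expg4 k : k \in K -> k ^+ 4 = 1.
Proof. by rewrite -oK; apply: expg_cardG. Qed.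

Lemma coord_expgp k x : k \in K -> x \in P -> (k * x) ^+ p = pm1 p k.
Proof.
move=> Kk Px; rewrite coordX // -[in x ^+ p]oP expg_cardG // mulg1.
rewrite [in k ^+ p](divn_eq p 4) expgD mulnC expgM expg4 // expg1n mul1g /pm1.
have: odd (p %% 4) by rewrite odd_mod.
have: p %% 4 < 4 by rewrite ltn_pmod.
case: (p %% 4) => [|[|[|[|//]]]] //= _ _; apply/eqP.
by rewrite -(inj_eq (mulgI k)) mulgV -expgS expg4.
Qed.

Lemma pm1_coord k : (pm1 p k \in K) = (k \in K).
Proof. by rewrite /pm1; case: ifP => // _; rewrite groupV. Qed.

(** The p-th power kills P and is the injective map [pm1] on K, so the p-th roots of pm1 p k form
    the layer of k. This makes layer counts accessible to [agree_card_power] with q = p. *)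
Lemma card_layer_expgp (C : finType) (c : gT -> C) k a : k \in K ->
  #|[pred y in G | (c y == a) && (y ^+ p == pm1 p k)]| = layer_count P c k a.
Proof.
move=> Kk; rewrite /layer_count -!sum1_card (reindex_inj (mulgI k)) /=.
apply: eq_bigl => x; rewrite !inE.
apply/and3P/andP => [[Gkx -> /eqP xp] | [Px ->]]; last first.
  by rewrite coordM // coord_expgp // eqxx.
split=> //; have Gk := subsetP coord_subl k Kk.
have Gx : x \in G by rewrite -(groupMl x Gk).
have [l Kl [y Py Dx]] := coordP Gx.
move: xp; rewrite Dx mulgA (coord_expgp (groupM Kk Kl) Py) => kl.
suffices -> : l = 1 by rewrite mul1g.
apply: (mulgI k); rewrite mulg1; move: kl; rewrite /pm1.
by case: ifP => // _ /invg_inj.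
Qed.

Lemma layer_count_const (C : finType) (c : gT -> C) k a : k \in K ->
  ~~ split_layer K P c k -> layer_count P c k a = ((c k == a) * p)%N.
Proof.
move=> Kk; rewrite /split_layer Kk negb_exists /= => /forallP kP.
have {}kP x : x \in P -> c (k * x) = c k.
  by move=> Px; have := kP x; rewrite Px /= negbK => /eqP.
rewrite /layer_count; case: eqP => [<- | ka]; last first.
  by apply: eq_card0 => x; rewrite !inE; apply/andP=> -[/kP-> /eqP].
rewrite mul1n -oP; apply: eq_card => x; rewrite !inE.
by case Px: (x \in P) => //=; rewrite kP ?eqxx.
Qed.

(** A count below p is determined by its residue modulo p. *)
Lemma layer_count_split (C : finType) (c : gT -> C) k a :
  split_layer K P c k -> layer_count P c k a < p.
Proof.
case/andP=> Kk /existsP[x /andP[Px cx]]; rewrite -oP /layer_count.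
have [ck | ck] := eqVneq (c k) a.
  apply: proper_card; apply/properP; split.
    by apply/subsetP=> y; rewrite inE => /andP[].
  by exists x => //; rewrite !inE -ck (negPf cx) andbF.
apply: proper_card; apply/properP; split; first by apply/subsetP=> y; rewrite inE => /andP[].
by exists 1 => //; rewrite !inE mulg1 (negPf ck) andbF.
Qed.

Lemma sum_layer_count (C : finType) (c : gT -> C) a :
  \sum_(k in K) layer_count P c k a = #|[pred g in G | c g == a]|.
Proof.
rewrite -sum1_card; case/dprodP: defG => _ defKP _ tiKP.
have divK k x : k \in K -> x \in P -> divgr K P (k * x) = k.
  by move=> Kk Px; rewrite divgrMid.
rewrite [RHS](partition_big (divgr K P) (mem K)) /=; last first.
  by move=> g /andP[]; rewrite -defKP => Gg _; apply: mem_divgr.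
apply: eq_bigr => k Kk; rewrite /layer_count -sum1_card [RHS](reindex_inj (mulgI k)) /=.
apply: eq_bigl => x; rewrite !inE; apply/andP/andP=> [[Px ->] | [/andP[Gkx ->] /eqP dk]].
  by rewrite coordM // divK.
split=> //; have := Gkx; rewrite -defKP => /mem_remgr.
by rewrite -[remgr _ _ _](mulKg (divgr K P (k * x))) -divgr_eq dk mulKg.
Qed.

End Coordinates.

Section LayerCounts.
Variables (p : nat) (gT gT' : finGroupType).
Variables (G K P : {group gT}) (G' K' P' : {group gT'}).
Variables (C : finType) (c : gT -> C) (c' : gT' -> C).
Hypotheses (p_pr : prime p) (p_odd : odd p) (M : matched G G' c c').
Hypotheses (cGG : abelian G) (defG : K \x P = G) (oK : #|K| = 4) (oP : #|P| = p).
Hypotheses (cGG' : abelian G') (defG' : K' \x P' = G') (oK' : #|K'| = 4) (oP' : #|P'| = p).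

Lemma agree_pm1 : agree G G' c c' (fun x => c (pm1 p x)) (fun x => c' (pm1 p x)).
Proof.
by move=> x x' Gx Gx' cx; rewrite /pm1; case: ifP => // _; apply: (matchedV M).
Qed.

Lemma layer_count_mod k k' a : k \in K -> k' \in K' -> c k = c' k' ->
  layer_count P c k a = layer_count P' c' k' a %[mod p].
Proof.
move=> Kk Kk' ck.
have Gk := subsetP (coord_subl defG) k Kk; have Gk' := subsetP (coord_subl defG') k' Kk'.
rewrite -(card_layer_expgp p_odd cGG defG oK oP) // -(card_layer_expgp p_odd cGG' defG' oK' oP') //.
apply: (agree_card_power M cGG cGG'); rewrite ?pm1_coord //; last exact: agree_pm1.
exact: agree_color_eq.
Qed.

(** The color c k occurs in the layer of k between 1 and p - 1 times, so modulo p its count is not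
    zero. Hence pm1 p g' has a p-th root, which puts it and g' in K'; and the layer of g' is split,
    as a monochromatic one would give a count divisible by p. *)
Lemma split_layer_matched k g' : split_layer K P c k -> g' \in G' -> c k = c' g' ->
  split_layer K' P' c' g'.
Proof.
move=> sk Gg' ckg; have /andP[Kk _] := sk.
have Gk := subsetP (coord_subl defG) k Kk.
have T_lt := layer_count_split oP (c k) sk.
have T_gt : 0 < layer_count P c k (c k).
  by apply/card_gt0P; exists 1; rewrite !inE group1 mulg1 eqxx.
have Kg' : g' \in K'.
  have Gpk : pm1 p k \in G by rewrite pm1_coord.
  have Gpg' : pm1 p g' \in G' by rewrite pm1_coord.
  have := agree_card_power M cGG cGG' p_pr (agree_color_eq (c k)) Gpk Gpg' (agree_pm1 Gk Gg' ckg).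
  rewrite (card_layer_expgp p_odd cGG defG oK oP) // modn_small // => cE.
  move: T_gt; rewrite cE.
  case: (posnP #|[pred y in G' | (c' y == c k) && (y ^+ p == pm1 p g')]|) => [->|].
    by rewrite mod0n.
  case/card_gt0P=> y; rewrite !inE => /and3P[Gy _ /eqP yp] _.
  have [l Kl [x Px Dy]] := coordP defG' Gy.
  move: yp; rewrite Dy (coord_expgp p_odd cGG' defG' oK' oP') // => yp.
  by rewrite -(pm1_coord p) -yp pm1_coord.
case sg': (split_layer K' P' c' g') => //.
have := layer_count_mod (c k) Kk Kg' ckg.
rewrite (layer_count_const oP' (c k) Kg' (negbT sg')) modnMl modn_small // => T0.
by rewrite T0 in T_gt.
Qed.

End LayerCounts.

(** * The bijection for odd p *)

Section OddCase.
Variables (p : nat) (gT gT' : finGroupType).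
Variables (G K P : {group gT}) (G' K' P' : {group gT'}).
Variables (C : finType) (c : gT -> C) (c' : gT' -> C).
Hypotheses (p_pr : prime p) (p_odd : odd p) (M : matched G G' c c').
Hypotheses (cGG : abelian G) (defG : K \x P = G) (oK : #|K| = 4) (oP : #|P| = p).
Hypotheses (cGG' : abelian G') (defG' : K' \x P' = G') (oK' : #|K'| = 4) (oP' : #|P'| = p).

Let sKG := subsetP (coord_subl defG).
Let sPG := subsetP (coord_subr defG).
Let sKG' := subsetP (coord_subl defG').
Let sPG' := subsetP (coord_subr defG').

Let U := split_layer K P c.
Let U' := split_layer K' P' c'.

Let UU : agree G G' c c' U U'.
Proof.
move=> x x' Gx Gx' cx; apply/idP/idP => [Ux | Ux'].
  exact: (split_layer_matched p_pr p_odd M cGG defG oK oP cGG' defG' oK' oP' Ux Gx' cx).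
have M' := matched_sym M.
exact: (split_layer_matched p_pr p_odd M' cGG' defG' oK' oP' cGG defG oK oP Ux' Gx (esym cx)).
Qed.

Let UK k : U k -> k \in K. Proof. by case/andP. Qed.
Let UK' k : U' k -> k \in K'. Proof. by case/andP. Qed.

Let layerUU a : agree G G' c c'
  (fun k => if U k then layer_count P c k a else 0)
  (fun k => if U' k then layer_count P' c' k a else 0).
Proof.
move=> k k' Gk Gk' ck; rewrite (UU Gk Gk' ck); case: ifP => // Uk'.
have Uk : U k by rewrite (UU Gk Gk' ck).
have := layer_count_mod p_pr p_odd M cGG defG oK oP cGG' defG' oK' oP' a (UK Uk) (UK' Uk') ck.
by rewrite !modn_small // ?(layer_count_split oP a Uk) ?(layer_count_split oP' a Uk').
Qed.

Let card_color (hT : finGroupType) (H L Q : {group hT}) (e : hT -> C) a :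
    L \x Q = H -> #|Q| = p ->
  (#|[pred g in H | e g == a]| =
    \sum_(k in H) (if split_layer L Q e k then layer_count Q e k a else 0)
    + #|[pred k in L | ~~ split_layer L Q e k && (e k == a)]| * p)%N.
Proof.
move=> defH oQ; rewrite -(sum_layer_count defH) (bigID (split_layer L Q e)) /=; congr (_ + _)%N.
  rewrite -big_mkcondr /=; apply: eq_bigl => k; apply/andP/andP=> -[Hk sk]; split=> //.
    exact: (subsetP (coord_subl defH)).
  by case/andP: sk.
rewrite -sum1_card big_distrl /= [RHS]big_mkcond [LHS]big_mkcond; apply: eq_bigr => k _.
rewrite !inE; case Lk: (k \in L) => //=; case sk: (split_layer L Q e k) => //=.
by rewrite (layer_count_const oQ a Lk) ?sk //; case: eqP; rewrite ?mul1n ?mul0n.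
Qed.

(** Color classes have equal sizes and equal parts in split layers; the rest is p times the number
    of monochromatic layers of color a. *)
Let card_const_color a :
  #|[pred k in K | ~~ U k && (c k == a)]| = #|[pred k in K' | ~~ U' k && (c' k == a)]|.
Proof.
have := agree_card M (agree_color_eq a).
rewrite (card_color c a defG oP) (card_color c' a defG' oP').
rewrite (agree_sum M (layerUU a)) => /eqP; rewrite eqn_add2l eqn_pmul2r ?prime_gt0 //.
by move/eqP.
Qed.

Let odd_generators : exists x0 y0,
  [/\ x0 \in P, y0 \in P', x0 != 1, y0 != 1 & c x0 = c' y0].
Proof.
have [x0 Px0 x0_neq1] : exists2 x0, x0 \in P & x0 != 1.
  by apply/trivgPn; rewrite -cardG_gt1 oP prime_gt1.
have G1 := group1 G; have G1' := group1 G'.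
have c_x0 : c x0 != c 1.
  by apply: contra x0_neq1 => /eqP /(matched_inj1 M) ->//; apply: sPG.
(* The color of x0 occurs in P a number of times that is not 0 modulo p, hence in P'. *)
have := layer_count_mod p_pr p_odd M cGG defG oK oP cGG' defG' oK' oP' (c x0)
  (group1 K) (group1 K') (matched1 M).
have s1 : split_layer K P c 1.
  by rewrite /split_layer group1; apply/existsP; exists x0; rewrite Px0 mul1g.
rewrite modn_small ?(layer_count_split oP (c x0) s1) // => T1.
have : 0 < layer_count P c 1 (c x0).
  by apply/card_gt0P; exists x0; rewrite !inE Px0 mul1g eqxx.
rewrite T1; case: (posnP (layer_count P' c' 1 (c x0))) => [->|]; first by rewrite mod0n.
case/card_gt0P=> y0; rewrite !inE mul1g => /andP[Py0 /eqP cy0] _.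
exists x0, y0; split=> //; apply: contra c_x0 => /eqP y1.
by rewrite -cy0 y1 (matched1 M).
Qed.

(* Split layers are counted by a convolution; elsewhere c (k * x0) = c k. *)
Let card_pair x0 y0 d a : x0 \in P -> y0 \in P' -> c x0 = c' y0 ->
  #|[pred k in K | (c k == d) && (c (k * x0) == a)]|
    = #|[pred k in K' | (c' k == d) && (c' (k * y0) == a)]|.
Proof.
move=> Px0 Py0 cxy.
have splitC (hT : finGroupType) (H L Q : {group hT}) (e : hT -> C) z :
    L \x Q = H -> z \in Q ->
  (#|[pred k in L | (e k == d) && (e (k * z)%g == a)]| =
    \sum_(k in H) (split_layer L Q e k && (e k == d)) && (e (k * z)%g == a) +
    (d == a) * #|[pred k in L | ~~ split_layer L Q e k && (e k == a)]|)%N.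
  move=> defH Qz; rewrite -!sum1_card -big_mkcondr big_distrr /=.
  rewrite (bigID (split_layer L Q e)) /=; congr (_ + _)%N.
    apply: eq_bigl => k; rewrite !inE.
    case sk: (split_layer L Q e k); rewrite ?andbF //= andbT.
    have /andP[Lk _] := sk; rewrite Lk.
    by rewrite (subsetP (coord_subl defH)).
  rewrite big_mkcond [RHS]big_mkcond; apply: eq_bigr => k _; rewrite !inE.
  case Lk: (k \in L) => //=; case sk: (split_layer L Q e k); rewrite ?andbF //= andbT.
  have -> : e (k * z) = e k.
    move: sk; rewrite /split_layer Lk /= => /negbT; rewrite negb_exists => /forallP/(_ z).
    by rewrite Qz /= negbK => /eqP.
  case: (eqVneq (e k) a) => [->|ka]; first by rewrite eq_sym; case: eqP.
  by rewrite andbF.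
rewrite (splitC _ G K P c x0) // (splitC _ G' K' P' c' y0) // card_const_color.
congr (_ + _)%N.
have F1 : agree G G' c c' (fun k => U k && (c k == d)) (fun k => U' k && (c' k == d)).
  by move=> k k' Gk Gk' ck; rewrite (UU Gk Gk' ck) ck.
exact: (agree_corr M (fun b1 b2 : bool => (b1 && b2 : nat)) F1 (agree_color_eq a)
  (sPG Px0) (sPG' Py0) cxy).
Qed.

(** Lets a multiplier act independently on K, as the r-th power, and on P, as the i-th power. *)
Let coprime_multiplier r i : coprime 4 r -> coprime p i ->
  let m := chinese 4 p r i in
  [/\ coprime #|G| m, m = r %[mod 4] & m = i %[mod p]].
Proof.
move=> co_r co_i m.
have co4p : coprime 4 p by rewrite (@coprime_pexpl 2 2) // coprime2n.
have m4 : m = r %[mod 4] by apply: chinese_modl.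
have mp : m = i %[mod p] by apply: chinese_modr.
split=> //; rewrite -(dprod_card defG) oK oP coprimeMl.
by rewrite -coprime_modr m4 coprime_modr co_r -coprime_modr mp coprime_modr.
Qed.

Let coord_expg_mod (hT : finGroupType) (H L Q : {group hT}) k x m r i :
    abelian H -> L \x Q = H -> #|L| = 4 -> #|Q| = p -> k \in L -> x \in Q ->
  m = r %[mod 4] -> m = i %[mod p] -> (k * x) ^+ m = k ^+ r * x ^+ i.
Proof.
move=> cHH defH oL oQ Lk Qx mr mi; rewrite (coordX cHH defH) //.
rewrite -(expg_mod m (expg4 oL Lk)) mr expg_mod ?(expg4 oL Lk) //.
have xp : x ^+ p = 1 by rewrite -oQ expg_cardG.
by rewrite -(expg_mod m xp) mi expg_mod.
Qed.

Lemma odd_cayley : exists2 f : gT -> gT', {in G, forall g, f g \in G'} &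
  {in G &, forall g h, c (g * h^-1) = c' (f g * (f h)^-1)}.
Proof.
have [x0 [y0 [Px0 Py0 x0_neq1 y0_neq1 cxy]]] := odd_generators.
(* The colors of k and k * x0 govern the whole layer of k, because multipliers congruent to 1 modulo
   4 fix k and carry x0 to each of its nontrivial powers. *)
have [|||||fK fKK' fKE] := @order4_cayley _ _ K K' (C * C)%type
  (fun k => (c k, c (k * x0))) (fun k => (c' k, c' (k * y0))) oK oK'.
- by move=> k Kk [/(matched_inj1 M)->//]; apply: sKG.
- by move=> k Kk [/(matched_inj1' M)->//]; apply: sKG'.
- by rewrite !mul1g cxy (matched1 M).
- move=> [d a]; have := card_pair d a Px0 Py0 cxy.
  by congr (_ = _); apply: eq_card => k; rewrite !inE xpair_eqE.
- move=> k k' Kk Kk' [ck ckx].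
  (* A multiplier congruent to -1 modulo 4 and to 1 modulo p inverts K and fixes P. *)
  have [co_m m4 mp] := @coprime_multiplier 3 1 isT (coprimen1 _).
  congr pair; first by apply: (matchedV M) => //; [apply: sKG | apply: sKG'].
  have := matched_expg M cGG cGG' co_m (coordM defG Kk Px0) (coordM defG' Kk' Py0) ckx.
  rewrite (coord_expg_mod cGG defG oK oP Kk Px0 m4 mp).
  rewrite (coord_expg_mod cGG' defG' oK' oP' Kk' Py0 m4 mp).
  have V3 (hT : finGroupType) (L : {group hT}) l : #|L| = 4 -> l \in L -> l ^+ 3 = l^-1.
    by move=> oL Ll; apply: (mulgI l); rewrite mulgV -expgS (expg4 oL).
  by rewrite !expg1 (V3 _ K) ?(V3 _ K').
have oP0 (hT : finGroupType) (Q : {group hT}) z : #|Q| = p -> z \in Q -> z != 1 -> <[z]> = Q.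
  move=> oQ Qz z1; apply/eqP; rewrite eqEcard cycle_subG Qz oQ /=.
  have oz_neq1 : #[z] != 1%N by rewrite order_eq1.
  have := order_dvdG Qz; rewrite oQ => /(prime_nt_dvdP p_pr oz_neq1) oz.
  by rewrite -oz.
have genP := oP0 _ P x0 oP Px0 x0_neq1; have genP' := oP0 _ P' y0 oP' Py0 y0_neq1.
have oxy : #[y0] %| #[x0] by rewrite /order genP genP' oP oP'.
pose al := eltm oxy.
have alP x : x \in P -> al x \in P'.
  by rewrite -genP => /cycleP[i ->]; rewrite /al eltmE -genP' mem_cycle.
have alM x y : x \in P -> y \in P -> al (x * y^-1) = al x * (al y)^-1.
  by rewrite -genP => Px Py; rewrite /al morphM ?groupV // morphV.
have color k x : k \in K -> x \in P -> forall k', k' \in K' ->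
    (c k, c (k * x0)) = (c' k', c' (k' * y0)) -> c (k * x) = c' (k' * al x).
  move=> Kk Px k' Kk' [ck ckx]; move: Px; rewrite -genP => /cycleP[i ->].
  (* If x0 ^+ i = 1, the first color of the pair suffices; otherwise a multiplier congruent to 1
     modulo 4 and to i modulo p turns k * x0 into k * x0 ^+ i. *)
  rewrite /al eltmE; have [p_i | p'i] := boolP (p %| i).
    have Xi (hT : finGroupType) (Q : {group hT}) z : #|Q| = p -> z \in Q -> z ^+ i = 1.
      by move=> oQ Qz; apply/eqP; rewrite -order_dvdn (dvdn_trans _ p_i) // -oQ order_dvdG.
    by rewrite (Xi _ P) ?(Xi _ P') // !mulg1.
  have [co_m m4 mp] := @coprime_multiplier 1 i isT (etrans (prime_coprime i p_pr) p'i).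
  have := matched_expg M cGG cGG' co_m (coordM defG Kk Px0) (coordM defG' Kk' Py0) ckx.
  rewrite (coord_expg_mod cGG defG oK oP Kk Px0 m4 mp).
  by rewrite (coord_expg_mod cGG' defG' oK' oP' Kk' Py0 m4 mp) !expg1.
exists (fun g => fK (divgr K P g) * al (remgr K P g)) => [g Gg | g h Gg Gh].
  have KPg : g \in K * P by case/dprodP: defG => _ ->.
  by rewrite (coordM defG') ?fKK' ?alP ?mem_divgr ?mem_remgr.
have [KPg KPh] : g \in K * P /\ h \in K * P by case/dprodP: defG => _ ->.
rewrite {1}(divgr_eq K P g) {1}(divgr_eq K P h).
have Kg := mem_divgr KPg; have Pg := mem_remgr KPg.
have Kh := mem_divgr KPh; have Ph := mem_remgr KPh.
move: (divgr K P g) (divgr K P h) (remgr K P g) (remgr K P h) Kg Kh Pg Ph => k l x y Kk Kl Px Py.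
have swap (hT : finGroupType) (H L Q : {group hT}) k1 k2 x1 x2 :
    abelian H -> L \x Q = H -> k1 \in L -> k2 \in L -> x1 \in Q -> x2 \in Q ->
  k1 * x1 * (k2 * x2)^-1 = (k1 * k2^-1) * (x1 * x2^-1).
  move=> cHH defH Lk1 Lk2 Qx1 Qx2.
  have sLH := subsetP (coord_subl defH); have sQH := subsetP (coord_subr defH).
  have [Hk1 Hk2 Hx1 Hx2] : [/\ k1 \in H, k2 \in H, x1 \in H & x2 \in H].
    by rewrite (sLH k1) ?(sLH k2) ?(sQH x1) ?(sQH x2).
  have -> : (k2 * x2)^-1 = k2^-1 * x2^-1 by rewrite (centsP cHH k2 Hk2 x2 Hx2) invMg.
  by rewrite (abelian_mulgACA cHH) ?groupV.
rewrite (swap _ G K P) // (swap _ G' K' P') ?fKK' ?alP // -alM //.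
apply: color; rewrite ?groupM ?groupV ?fKK' //.
exact: fKE.
Qed.

End OddCase.

Lemma sconstE (gT : finGroupType) (X Y : {set gT}) z :
  sconst X Y z = #|[set x in X | x^-1 * z \in Y]|.
Proof.
have inj : injective (fun x : gT => (x, x^-1 * z)) by move=> x y [].
rewrite -(card_imset _ inj); apply: eq_card => -[x y].
rewrite !inE /=; apply/andP/imsetP => [[/andP[Xx Yy] /eqP <-] | [u + [-> ->]]].
  by exists x; rewrite ?inE ?Xx mulKg.
by rewrite inE => /andP[-> ->]; rewrite mulKVg.
Qed.

Lemma coprime_dprod (p : nat) (gT : finGroupType) (G : {group gT}) :
    prime p -> odd p -> abelian G -> #|G| = (4 * p)%N ->
  exists K P : {group gT}, [/\ K \x P = G, #|K| = 4 & #|P| = p].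
Proof.
move=> p_pr p_odd cGG oG.
have nilG := abelian_nil cGG.
have p'4 : p^'.-nat 4.
  rewrite p'natE // -[4%N]/(2 ^ 2)%N Euclid_dvdX // andbT dvdn_prime2 //.
  by apply: contraTneq p_odd => ->.
have oP : #|'O_p(G)| = p.
  rewrite (card_Hall (nilpotent_pcore_Hall p nilG)) oG partnM ?(prime_gt0 p_pr) //.
  by rewrite (part_p'nat p'4) mul1n part_pnat_id ?pnat_id.
have defG : 'O_p^'(G) \x 'O_p(G) = G by rewrite dprodC; apply: nilpotent_pcoreC.
exists 'O_p^'(G)%G, 'O_p(G)%G; split=> //.
by apply/eqP; rewrite -(eqn_pmul2r (prime_gt0 p_pr)) -oG -(dprod_card defG) oP.
Qed.

(** * Schur rings *)

Section SchurRingColors.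
Variables (gT gT' : finGroupType) (G : {group gT}) (G' : {group gT'}).
Variables (S : {set {set gT}}) (S' : {set {set gT'}}) (phi : {set gT} -> {set gT'}).
Hypotheses (SG : is_Sring G S) (SG' : is_Sring G' S') (phiP : alg_iso S S' phi).

Let part : partition S G. Proof. by case: SG. Qed.
Let part' : partition S' G'. Proof. by case: SG'. Qed.
Let S1 : [set 1] \in S. Proof. by case: SG. Qed.
Let S1' : [set 1] \in S'. Proof. by case: SG'. Qed.
Let SV X : X \in S -> X^-1 \in S. Proof. by case: SG => _ _ + _ _; apply. Qed.
Let SV' X : X \in S' -> X^-1 \in S'. Proof. by case: SG' => _ _ + _ _; apply. Qed.

Let block_mem (hT : finGroupType) (H : {group hT}) (B : {set {set hT}}) g :
  partition B H -> g \in H -> pblock B g \in B /\ g \in pblock B g.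
Proof. by move=> pB Hg; rewrite pblock_mem ?mem_pblock (cover_partition pB). Qed.

Let blockE (hT : finGroupType) (H : {group hT}) (B : {set {set hT}}) X g :
  partition B H -> X \in B -> g \in X -> pblock B g = X.
Proof. by case/and3P=> _ tB _ BX Xg; apply: def_pblock tB BX Xg. Qed.

Let block_sub (hT : finGroupType) (H : {group hT}) (B : {set {set hT}}) X g :
  partition B H -> X \in B -> g \in X -> g \in H.
Proof.
by move=> pB BX Xg; rewrite -(cover_partition pB); apply/bigcupP; exists X.
Qed.

Let block_ex (hT : finGroupType) (H : {group hT}) (B : {set {set hT}}) X :
  partition B H -> X \in B -> exists g, g \in X.
Proof. by case/and3P=> _ _ B0 BX; apply/set0Pn; apply: contraNneq B0 => <-. Qed.

(** Both groups are colored by the basic sets of [S'], with [phi] carrying over those of [S]. *)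
Let c g := phi (pblock S g).
Let c' g := pblock S' g.

Let phiS X : X \in S -> phi X \in S'.
Proof. by case: phiP => _ <- _; apply: imset_f. Qed.

Let phi_inj : {in S &, injective phi}. Proof. by case: phiP. Qed.

Let phi_ex Y : Y \in S' -> exists2 X, X \in S & phi X = Y.
Proof. by case: phiP => _ <- _ /imsetP[X SX ->]; exists X. Qed.

Let phi_const X Y Z z z' : X \in S -> Y \in S -> Z \in S -> z \in Z -> z' \in phi Z ->
  sconst X Y z = sconst (phi X) (phi Y) z'.
Proof. by case: phiP => _ _ phiC SX SY SZ; apply: phiC. Qed.

(** If X is the basic set sent to {1}, the product of X and {1} has coefficient 1 on X; hence {1}
    times the image of {1} contains 1, so that image is {1}. *)
Let phi1 : phi [set 1] = [set 1].
Proof.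
have [X SX phiX] := phi_ex S1'.
have [x Xx] := block_ex part SX.
have cX : sconst X [set 1] x = 1%N.
  rewrite sconstE; apply/eqP/cards1P; exists x; apply/setP=> y; rewrite !inE.
  rewrite -(inj_eq (mulgI y)) mulKVg mulg1 eq_sym.
  by case: eqP => [->|]; rewrite ?Xx ?andbF.
have := @phi_const _ _ X x 1 SX S1 SX Xx; rewrite phiX set11 cX => /(_ isT).
rewrite sconstE => c1; have : 0 < #|[set y in [set 1] | y^-1 * 1 \in phi [set 1]]| by rewrite -c1.
case/card_gt0P=> y; rewrite !inE mulg1 => /andP[/eqP-> ]; rewrite invg1 => p1.
by rewrite -(blockE part' (phiS S1) p1); apply: (blockE part' S1'); rewrite set11.
Qed.

Let color_mem X g : X \in S -> g \in G -> (c g == phi X) = (g \in X).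
Proof.
move=> SX Gg; have [Sg gg] := block_mem part Gg.
apply/eqP/idP => [/phi_inj <- // | Xg]; by rewrite /c (blockE part SX Xg).
Qed.

Let color_mem' Y g : Y \in S' -> g \in G' -> (c' g == Y) = (g \in Y).
Proof.
move=> SY Gg; have [Sg gg] := block_mem part' Gg.
by apply/eqP/idP => [<- // | Yg]; rewrite /c' (blockE part' SY Yg).
Qed.

Lemma Sring_matched : matched G G' c c'.
Proof.
have c1 : c 1 = [set 1] by rewrite /c (blockE part S1) ?set11 // phi1.
have c1' : c' 1 = [set 1] by rewrite /c' (blockE part' S1') ?set11.
split.
- by rewrite c1 c1'.
- move=> x Gx; rewrite c1 -phi1 => /eqP; rewrite color_mem // => /set1P //.
- by move=> x Gx; rewrite c1' => /eqP; rewrite color_mem' // => /set1P.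
- move=> x Gx; have [Sx xx] := block_mem part Gx.
  have [x' Xx'] := block_ex part' (phiS Sx).
  by exists x'; [apply: (block_sub part' (phiS Sx)) | rewrite /c' (blockE part' (phiS Sx) Xx')].
- move=> x' Gx'; have [Sx xx] := block_mem part' Gx'.
  have [X SX phiX] := phi_ex Sx; have [x Xx] := block_ex part SX.
  exists x; first exact: (block_sub part SX).
  by rewrite /c (blockE part SX Xx).
- move=> x x' Gx Gx' cx; have [Sx xx] := block_mem part Gx; have [Sx' xx'] := block_mem part' Gx'.
  set X := pblock S x in Sx xx; set X' := pblock S' x' in Sx' xx'.
  have phiX : phi X = X' by [].
  have XVx : x^-1 \in X^-1 by rewrite inE invgK.
  (* X^-1 is the basic set Y for which 1 occurs in the product X Y, so [phi] commutes with
     inversion. *)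
  have cXV : 0 < sconst X X^-1 1.
    by rewrite sconstE; apply/card_gt0P; exists x; rewrite inE xx mulg1.
  have p1 : 1 \in phi [set 1] by rewrite phi1 set11.
  move: cXV; rewrite (phi_const Sx (SV Sx) S1 (set11 1) p1) sconstE phiX.
  case/card_gt0P=> y; rewrite !inE mulg1 => /andP[X'y pXVy].
  rewrite /c (blockE part (SV Sx) XVx) -(blockE part' (phiS (SV Sx)) pXVy) /c'.
  have X'Vy : y^-1 \in X'^-1 by rewrite inE invgK.
  have X'Vx : x'^-1 \in X'^-1 by rewrite inE invgK.
  by rewrite (blockE part' (SV' Sx') X'Vy) (blockE part' (SV' Sx') X'Vx).
move=> a b x x' Gx Gx' cx.
(* A color that is not a basic set of [S'] occurs on neither side. *)
have [S'a | S'a] := boolP (a \in S'); last first.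
  rewrite !eq_card0 // => y; rewrite !inE; apply: contraNF S'a.
    by case/and3P=> Gy /eqP<- _; rewrite /c' (block_mem part' Gy).1.
  by case/and3P=> Gy /eqP<- _; rewrite phiS // (block_mem part Gy).1.
have [S'b | S'b] := boolP (b \in S'); last first.
  rewrite !eq_card0 // => y; rewrite !inE; apply: contraNF S'b.
    case/and3P=> Gy _ /eqP<-; have Gyx : y^-1 * x' \in G' by rewrite groupM ?groupV.
    by rewrite /c' (block_mem part' Gyx).1.
  case/and3P=> Gy _ /eqP<-; have Gyx : y^-1 * x \in G by rewrite groupM ?groupV.
  by rewrite phiS // (block_mem part Gyx).1.
have [A SA phiA] := phi_ex S'a; have [B SB phiB] := phi_ex S'b.
have [Sx xx] := block_mem part Gx.
have Xx' : x' \in phi (pblock S x) by rewrite -/(c x) cx; apply: (block_mem part' Gx').2.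
have := phi_const SA SB Sx xx Xx'; rewrite !sconstE phiA phiB.
congr (_ = _); apply: eq_card => y; rewrite !inE.
  apply/andP/and3P => [[Ay By] | [Gy ay yb]].
    have Gy := block_sub part SA Ay.
    by rewrite Gy -phiA -phiB !color_mem ?Ay ?By ?groupM ?groupV.
  by move: ay yb; rewrite -phiA -phiB !color_mem ?groupM ?groupV.
apply/andP/and3P => [[Ay By] | [Gy ay yb]].
  have Gy := block_sub part' S'a Ay.
  by rewrite Gy !color_mem' ?Ay ?By ?groupM ?groupV.
by move: ay yb; rewrite !color_mem' ?groupM ?groupV.
Qed.

(** Right translation by (f 1)^-1 leaves quotients unchanged and sends f 1 to 1, so [f0] preserves
    colors as well as colors of quotients. It is injective because only 1 has the color of 1, and
    onto by cardinality. *)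
Lemma comb_iso_of_cayley (f : gT -> gT') : {in G, forall g, f g \in G'} ->
    {in G &, forall g h, c (g * h^-1) = c' (f g * (f h)^-1)} ->
  exists f0 : gT -> gT', comb_iso G G' S S' f0 /\ (forall X, X \in S -> phi X = f0 @: X).
Proof.
move=> fG' fE; have M := Sring_matched; pose f0 g := f g * (f 1)^-1.
have Gf1 : f 1 \in G' by rewrite fG'.
have f0G' g : g \in G -> f0 g \in G' by move=> Gg; rewrite groupM ?groupV ?fG'.
have f0E : {in G &, forall g h, c (g * h^-1) = c' (f0 g * (f0 h)^-1)}.
  by move=> g h Gg Gh; rewrite fE // /f0 invMg invgK mulgA mulgKV.
have f0c g : g \in G -> c g = c' (f0 g).
  by move=> Gg; rewrite -[g in LHS]mulg1 -[1 in LHS]invg1 fE ?group1.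
have f0_inj : {in G &, injective f0}.
  move=> g h Gg Gh f0gh; apply/eqP; rewrite eq_mulgV1; apply/eqP.
  apply: (matched_inj1 M); first by rewrite groupM ?groupV.
  by rewrite f0E // f0gh mulgV -(matched1 M).
have f0_onto : f0 @: G = G'.
  apply/eqP; rewrite eqEcard card_in_imset // (matched_card M) leqnn andbT.
  by apply/subsetP=> _ /imsetP[g Gg ->]; apply: f0G'.
have f0X X : X \in S -> phi X = f0 @: X.
  move=> SX; apply/setP=> y; apply/idP/imsetP => [phiy | [g Xg ->]].
    have : y \in G' by apply: (block_sub part' (phiS SX)).
    rewrite -f0_onto => /imsetP[g Gg Dy]; exists g => //.
    by rewrite -color_mem // f0c // -Dy color_mem' ?phiS // Dy f0G'.
  have Gg := block_sub part SX Xg.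
  by rewrite -color_mem' ?phiS ?f0G' // -f0c // color_mem.
exists f0; split=> //; split=> // X SX; rewrite -f0X //; split; first exact: phiS.
move=> g h Gg Gh; have Ghg : h * g^-1 \in G by rewrite groupM ?groupV.
have Ghg' : f0 h * (f0 g)^-1 \in G' by rewrite groupM ?groupV ?f0G'.
by rewrite /cay_arc -(color_mem SX Ghg) f0E // (color_mem' (phiS SX) Ghg').
Qed.

End SchurRingColors.

Lemma matched_cayley (p : nat) (gT gT' : finGroupType) (G : {group gT}) (G' : {group gT'})
    (C : finType) (c : gT -> C) (c' : gT' -> C) :
    prime p -> abelian G -> abelian G' -> #|G| = (4 * p)%N -> matched G G' c c' ->
  exists2 f : gT -> gT', {in G, forall g, f g \in G'} &
    {in G &, forall g h, c (g * h^-1) = c' (f g * (f h)^-1)}.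
Proof.
move=> p_pr cGG cGG' oG M; have oG' : #|G'| = (4 * p)%N by rewrite -(matched_card M).
have [p2 | p_odd] := even_prime p_pr.
  by apply: (order8_cayley M) => //; rewrite oG p2.
have [K [P [defG oK oP]]] := coprime_dprod p_pr p_odd cGG oG.
have [K' [P' [defG' oK' oP']]] := coprime_dprod p_pr p_odd cGG' oG'.
exact: (odd_cayley p_pr p_odd M cGG defG oK oP cGG' defG' oK' oP').
Qed.

Local Close Scope group_scope.

Theorem theorem1 (p : nat) (gT : finGroupType) (G : {group gT}) :
  prime p -> abelian G -> #|G| = 4 * p -> separable_group G.
Proof.
move=> p_pr cGG oG S SG gT' G' S' phi cGG' SG' phiP.
have M := Sring_matched SG SG' phiP.
have [f fG' fE] := matched_cayley p_pr cGG cGG' oG M.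
exact: (comb_iso_of_cayley SG SG' phiP fG' fE).
Qed.
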